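(* In the Hardy space $H^2(\Pi_+)$ of the upper half-plane consider the dictionary $$D=\left\{\frac{e^{i\theta}}{\sqrt{\pi}}\,\frac{\sqrt{|\operatorname{Im} a|}}{z-a}:\ a\in\Pi_-,\ \theta\in\mathbb{R}\right\}.$$ Then $$\inf_{\substack{g_1,g_2\in D\\ g_1\neq g_2}}\ \sup_{g\in D}\left|\left\langle\frac{g_1-g_2}{\|g_1-g_2\|},g\right\rangle\right|>10^{-2},$$ and consequently $D$ is not universal in $H^2(\Pi_+)$.
   Context: $\Pi_+=\{z\in\mathbb{C}:\operatorname{Im} z>0\}$, $\Pi_-=\{z\in\mathbb{C}:\operatorname{Im} z<0\}$. $H^2(\Pi_+)$ is the space of complex functions $f$ holomorphic in $\Pi_+$ with $\|f\|:=\sup_{y>0}\left(\int_{\mathbb{R}}|f(x+iy)|^2\,dx\right)^{1/2}<\infty$; each such $f$ has angular boundary limits $f(x)$ for almost all $x\in\mathbb{R}$, and $\|f\|$ equals the $L_2(\mathbb{R})$-norm of the boundary function. It is a complex Hilbert space with $\langle f,g\rangle=\int_{\mathbb{R}}f(x)\overline{g(x)}\,dx$ (boundary values). A dictionary in a Hilbert space $H$ is a subset $D$ of the unit sphere of $H$ with $\overline{\mathrm{span}}\,D=H$. For $m\in\mathbb{N}=\{1,2,\dots\}$, $\Sigma_m(D)=\{\sum_{k=1}^m\lambda_kg_k:\ \lambda_k\text{ scalars},\ g_k\in D\}$, $\sigma_m(x)=\mathrm{dist}(x,\Sigma_m(D))$, and $\sigma_0(x)$ is the norm of $x$. A dictionary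 $D$ in $H$ is called universal if for every strictly decreasing real sequence $\alpha_0>\alpha_1>\dots$ with $\alpha_m\to0$ there exists $x\in H$ with $\sigma_m(x)=\alpha_m$ for all $m=0,1,2,\dots$ *)

(* Defs.v *)
From HB Require Import structures.
From mathcomp Require Import all_boot all_order all_algebra.
From mathcomp Require Import all_classical all_reals all_analysis.
From mathcomp Require Import complex.

Set Implicit Arguments.
Unset Strict Implicit.
Unset Printing Implicit Defensive.

Import Order.TTheory GRing.Theory Num.Theory.
Import numFieldTopology.Exports numFieldNormedType.Exports.

Local Open Scope classical_set_scope.
Local Open Scope complex_scope.
Local Open Scope ring_scope.

(* A complex normed space is given as a subset H of an ambient R[i]-module V
   together with a norm, which is only meaningful on H. *)
Section Dictionaries.
Variables (R : realType) (V : lmodType R[i]) (H : set V) (nrm : V -> R).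
Implicit Types D : set V.

(* At most m distinct elements of D: the g k may coincide and the scalars may
   vanish. For m = 0 this is {0}, so sigma D 0 is the norm. *)
Definition Sigma D (m : nat) : set V :=
  [set h | exists (c : 'I_m -> R[i]) (g : 'I_m -> V),
     (forall k, D (g k)) /\ h = \sum_(k < m) c k *: g k].

Definition sigma D (m : nat) (x : V) : R :=
  inf [set nrm (x - h) | h in Sigma D m].

(* Stated for an arbitrary subset D rather than only for dictionaries, so that
   the negation cannot hold merely because D fails to be a dictionary. *)
Definition universal D : Prop :=
  forall alpha : R^nat,
    (forall n, alpha n.+1 < alpha n) -> alpha @ \oo --> (0 : R) ->
    exists2 x, H x & forall m, sigma D m x = alpha m.

End Dictionaries.

Section HardySpace.
Variable R : realType.

Definition upper : Type := {z : R[i] | 0 < complex.Im z}.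

Implicit Types f g : upper -> R[i].

(* Zero extension; the junk value is irrelevant since the half-plane is open
   and only limits from inside it are ever taken. *)
Definition extend f (z : R[i]) : R[i] := if insub z is Some w then f w else 0.

(* R[i]^o is R[i] as a normed space over itself, so this is complex
   differentiability at every point of the half-plane. *)
Definition holomorphic f : Prop :=
  forall z : upper, derivable (extend f : R[i]^o -> R[i]^o) (val z) 1.

(* Extended-real valued; +oo when the supremum is infinite. *)
Definition hardy_norm f : \bar R :=
  ereal_sup [set Lnorm (@lebesgue_measure R) 2%:E
                   (fun x : R => (Normc.normc (extend f (x +i* y)))%:E)
            | y in [set y : R | 0 < y]].

Definition H2 : set (upper -> R[i]) :=
  [set f | holomorphic f /\ (hardy_norm f < +oo)%E].

(* The norm of H2, meaningful for f in H2 only. *)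
Definition norm2 f : R := fine (hardy_norm f).

Definition stolz_angle (x c : R) : set R[i] :=
  [set z | 0 < complex.Im z /\ `|complex.Re z - x| < c * complex.Im z].

Definition angular_limit f (x : R) (l : R[i]) : Prop :=
  forall c : R, 0 < c ->
    (extend f : R[i]^o -> R[i]^o) @ within (stolz_angle x c) (nbhs (x%:C : R[i]^o))
      --> (l : R[i]^o).

(* Boundary value at x; 0 when there is no angular limit at x. *)
Definition boundary f (x : R) : R[i] := xget 0 [set l | angular_limit f x l].

Definition h2_inner f g : R[i] :=
  let h x := boundary f x * (boundary g x)^* in
  Rintegral (@lebesgue_measure R) setT (fun x => complex.Re (h x)) +i*
  Rintegral (@lebesgue_measure R) setT (fun x => complex.Im (h x)).

Definition cauchy_kernel (theta : R) (a : R[i]) : upper -> R[i] := fun z =>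
  (cos theta +i* sin theta) / (Num.sqrt pi)%:C *
  ((Num.sqrt `|complex.Im a|)%:C / (val z - a)).

Definition cauchy_dictionary : set (upper -> R[i]) :=
  [set g | exists (a : R[i]) (theta : R), complex.Im a < 0 /\ g = cauchy_kernel theta a].

End HardySpace.

(* Main.v *)
Require Import Defs.
From HB Require Import structures.
From mathcomp Require Import all_boot all_order all_algebra.
From mathcomp Require Import all_classical all_reals all_analysis.
From mathcomp Require Import complex.
From mathcomp Require Import measurable_realfun.
From mathcomp Require Import ring lra.

Set Implicit Arguments.
Unset Strict Implicit.
Unset Printing Implicit Defensive.

Import Order.TTheory GRing.Theory Num.Theory.
Import numFieldTopology.Exports numFieldNormedType.Exports.

Local Open Scope classical_set_scope.
Local Open Scope complex_scope.
Local Open Scope ring_scope.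

(** Write S(p, q) = i / (q - conj p) and let f_s(z) be the sum of c / (z - conj p)
over the pairs (c, p) of a list s of coefficients and points of the upper
half-plane. Every element of the span of the dictionary has this form, and
2 pi S(p, q) is the integral over the real line of
1 / ((x - conj p) (x - q)). Hence the squared norm of f_s is 2 pi times the
Gram sum of s, the Hermitian form with matrix S, and no Hilbert space theory
is required for the elements of the span: the reproducing property becomes the
algebraic identity that subtracting from f_s its projection on the kernel at w
lowers the Gram sum by exactly 2 Im w |f_s(w)|^2 (lemma gram_project). That the
supremum over horizontal lines in the definition of the norm is the limit at
height 0 is Schur's product theorem for the matrix S (lemma gram_raise_le).

The quantitative core is lemma two_kernels: a combination f of two kernels
satisfies gram <= 32 Im w |f(w)|^2 for some w, that is, some element of the
dictionary has inner product at least |f| / 4 with f, whatever the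
coefficients and the two points. An affine map of the half-plane reduces this
to points p, q with p q = -1, for which the isometry f(z) |-> f(-1/z) / z of
the Hardy space permutes the two kernels up to scalars. Its eigenspaces in the span are the
multiples of (z + i) and of (z - i) over the common denominator, so the Gram
sum is diagonal in the numerator and averaging over the two test points w and
-1/w removes the cross terms. It then suffices to find w comparable to p but
away from the fixed point i: p itself if it is not close to i, and 3i
otherwise.

The first claim follows at once, with 1/4 in place of 1/100. For the second
claim take a sequence starting with 1, 127/128, 1/256. A vector x realizing
it lies within 1/128 of a combination h of two kernels. By the core
inequality one kernel k, suitably scaled, has |h - k| <= (31/32) |h|, so
|x - k| < 127/128, which contradicts the distance from x to the multiples of
single kernels. Only the triangle inequality is used for x itself, and it
comes from Minkowski's inequality on each horizontal line. *)

(** * Integration over the real line from antiderivatives *)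

Section LineIntegrals.
Context {R : realType}.
Notation mu := (@lebesgue_measure R).
Implicit Types f g F G : R -> R.

Lemma ge0_integral_line f F (l m : R) :
  (forall x, 0 <= f x) -> continuous f -> (forall x : R, is_derive x 1 F (f x)) ->
  F x @[x --> +oo] --> l -> F x @[x --> -oo] --> m ->
  (\int[mu]_x (f x)%:E = (l - m)%:E)%E.
Proof.
move=> f0 cf dF Fl Fm.
have cF : continuous F.
  move=> x; apply/differentiable_continuous/derivable1_diffP.
  by case: (dF x).
have mf : measurable_fun [set: R] (fun x => (f x)%:E).
  by apply/measurable_EFinP; exact: continuous_measurable_fun.
have right : (\int[mu]_(x in `[0%R, +oo[) (f x)%:E = l%:E - (F 0)%:E)%E.
  apply: ge0_continuous_FTC2y => //.
  - exact: continuous_subspaceT.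
  - exact/cvg_at_right_filter/cF.
  - move=> x _; rewrite derive1E; by case: (dF x).
have left : (\int[mu]_(x in `]-oo, 0%R]) (f x)%:E = (F 0)%:E - m%:E)%E.
  rewrite -[0%R]oppr0 ge0_integration_by_substitutionNy; first last.
  - by move=> x _; exact: f0.
  - exact: continuous_subspaceT.
  have dG (x : R) : is_derive x 1 (fun x => - F (- x)) (f (- x)).
    have dFx := dF (- x).
    have dN : is_derive x 1 (-%R : R -> R) (- 1).
      by have := is_deriveN (is_derive_id x (1:R)).
    have := is_deriveN (@is_derive1_comp _ F -%R x _ _ dFx dN).
    by rewrite mulrN1 opprK.
  have cG : continuous (fun x : R => - F (- x)).
    move=> x; apply/differentiable_continuous/derivable1_diffP.
    by case: (dG x).
  rewrite (@ge0_continuous_FTC2y _ (f \o -%R) (fun x => - F (- x)) 0 (- m)) //=.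
  - by rewrite !opprK addeC.
  - apply: continuous_subspaceT => x; apply: continuous_comp; last exact: cf.
    exact: opp_continuous.
  - apply: cvgN; exact/cvgNy_compNP.
  - apply: cvg_at_right_filter; exact: cG.
  - move=> x _; rewrite derive1E; by case: (dG x).
rewrite -set_itvNyy (@itv_bndbnd_setU _ _ -oo%O (BRight 0) +oo%O) //.
rewrite ge0_integral_setU //=; last 3 first.
- by apply: measurable_funS mf.
- move=> x _; rewrite lee_fin; exact: f0.
- apply/disj_setPS => x []; rewrite /= !in_itv/= andbT => /le_lt_trans h/h.
  by rewrite ltxx.
rewrite left integral_itv_obnd_cbnd ?right //; last exact: measurable_funS mf.
by rewrite -!EFinB -EFinD; congr EFin; ring.
Qed.

(** Integrability and value together, because the value alone, a total
function, says nothing about a function that is not integrable. *)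
Definition line_integral f (v : R) :=
  mu.-integrable setT (EFin \o f) /\ Rintegral mu setT f = v.

Lemma ge0_line_integral f F (l m : R) :
  (forall x, 0 <= f x) -> continuous f -> (forall x : R, is_derive x 1 F (f x)) ->
  F x @[x --> +oo] --> l -> F x @[x --> -oo] --> m ->
  line_integral f (l - m).
Proof.
move=> f0 cf dF Fl Fm; have E := ge0_integral_line f0 cf dF Fl Fm.
split; last by rewrite /Rintegral E.
apply/integrableP; split.
  by apply/measurable_EFinP; exact: continuous_measurable_fun.
under eq_integral do rewrite /= ger0_norm //.
by rewrite E ltry.
Qed.

Lemma line_integralD f g (v w : R) : line_integral f v -> line_integral g w ->
  line_integral (fun x => f x + g x) (v + w).
Proof.
move=> [fi <-] [gi <-]; split; last exact: RintegralD.
exact: (integrableD measurableT fi gi).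
Qed.

Lemma line_integralZ f (c v : R) : line_integral f v ->
  line_integral (fun x => c * f x) (c * v).
Proof.
move=> [fi <-]; split; last exact: RintegralZl.
exact: (integrableZl measurableT c fi).
Qed.

Lemma line_integral_ge0 f v :
  (forall x, 0 <= f x) -> line_integral f v -> 0 <= v.
Proof. by move=> f0 [_ <-]; apply: Rintegral_ge0. Qed.

(** Adding the dominating derivative makes the integrand nonnegative, which
reduces a conditionally signed integrand to the monotone case. *)
Lemma dominated_line_integral f g F G (l m l' m' : R) :
  continuous f -> continuous g -> (forall x, `|f x| <= g x) ->
  (forall x : R, is_derive x 1 F (f x)) -> (forall x : R, is_derive x 1 G (g x)) ->
  F x @[x --> +oo] --> l -> F x @[x --> -oo] --> m ->
  G x @[x --> +oo] --> l' -> G x @[x --> -oo] --> m' ->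
  line_integral f (l - m).
Proof.
move=> cf cg fg dF dG Fl Fm Gl Gm.
have g0 x : 0 <= g x by apply: le_trans (fg x).
have ig := ge0_line_integral g0 cg dG Gl Gm.
have ifg : line_integral (fun x => f x + g x) (l + l' - (m + m')).
  apply: (@ge0_line_integral _ (F \+ G)) => //.
  - move=> x; have := fg x; rewrite ler_norml => /andP[+ _].
    by rewrite -subr_ge0 opprK addrC addrC.
  - by move=> x; apply: cvgD; [exact: cf|exact: cg].
  - exact: cvgD.
  - exact: cvgD.
have := line_integralD ifg (line_integralZ (-1) ig).
have -> : (fun x => f x + g x + -1 * g x) = f by apply/funext => x; ring.
by have -> : l + l' - (m + m') + -1 * (l' - m') = l - m by ring.
Qed.

End LineIntegrals.

(** * Poisson kernels and their conjugates *)

Section CauchyIntegrals.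
Context {R : realType}.
Implicit Types (u v x : R).

Lemma sqr_dist_gt0 u v x : 0 < v -> 0 < (x - u) ^+ 2 + v ^+ 2.
Proof. by move=> v0; rewrite ltr_wpDl ?sqr_ge0 // exprn_gt0. Qed.

Lemma is_derive_atan_affine u v x : 0 < v ->
  is_derive x 1 (fun x : R => atan ((x - u) / v)) (v / ((x - u) ^+ 2 + v ^+ 2)).
Proof.
move=> v0.
have dg : is_derive x 1 (fun x : R => (x - u) / v) v^-1.
  have -> : (fun x : R => (x - u) / v) = (v^-1 \*: (id - cst u)).
    by apply/funext => y; rewrite /GRing.scale /= mulrC.
  by apply: is_derive_eq; rewrite subr0 /GRing.scale /= mulr1.
have := @is_derive1_comp R (@atan R) (fun x : R => (x - u) / v) x _ _ (is_derive1_atan _) dg.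
have -> : (1 + ((x - u) / v) ^+ 2)^-1 * v^-1 = v / ((x - u) ^+ 2 + v ^+ 2).
  have h := sqr_dist_gt0 u x v0.
  by field; rewrite !lt0r_neq0.
by [].
Qed.

Lemma is_derive_ln_dist u v x : 0 < v ->
  is_derive x 1 (fun x : R => ln ((x - u) ^+ 2 + v ^+ 2))
    ((x - u) * 2 / ((x - u) ^+ 2 + v ^+ 2)).
Proof.
move=> v0; have h := sqr_dist_gt0 u x v0.
have dg : is_derive x 1 (fun x : R => (x - u) ^+ 2 + v ^+ 2) ((x - u) * 2).
  have -> : (fun x : R => (x - u) ^+ 2 + v ^+ 2) = ((id - cst u) ^+ 2 + cst (v ^+ 2)).
    by apply/funext => y; rewrite fctE.
  apply: is_derive_eq; rewrite !fctE subr0 addr0 /GRing.scale /= mulr1 expr1.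
  by rewrite mulrC.
have := @is_derive1_comp R (@ln R) (fun x : R => (x - u) ^+ 2 + v ^+ 2) x _ _ (is_derive1_ln h) dg.
by rewrite mulrC.
Qed.

Lemma continuous_inv_dist u v : 0 < v ->
  continuous (fun x : R => ((x - u) ^+ 2 + v ^+ 2)^-1).
Proof.
move=> v0 x; apply: cvgV; first exact/lt0r_neq0/sqr_dist_gt0.
apply: cvgD; last exact: cvg_cst.
by apply: cvgM; (apply: cvgB; [exact: cvg_id|exact: cvg_cst]).
Qed.

Lemma cvgy_atan_affine u v : 0 < v ->
  atan ((x - u) / v) @[x --> +oo] --> pi / 2.
Proof.
move=> v0.
apply: (@cvg_comp _ _ _ (fun x => (x - u) / v) atan _ +oo); last exact: cvgy_atan.
apply: gt0_cvgMly => //; first by rewrite invr_gt0.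
exact: cvg_addrr.
Qed.

Lemma cvgNy_atan_affine u v : 0 < v ->
  atan ((x - u) / v) @[x --> -oo] --> - (pi / 2).
Proof.
move=> v0; apply/cvgNy_compNP.
have -> : (fun x => atan ((x - u) / v)) \o -%R = (fun x => - atan ((x + u) / v)).
  by apply/funext => x /=; rewrite -atanN -mulNr opprD.
apply: cvgN; rewrite -[u]opprK; exact: cvgy_atan_affine.
Qed.

Lemma line_integral_poisson u v : 0 < v ->
  line_integral (fun x => v / ((x - u) ^+ 2 + v ^+ 2)) pi.
Proof.
move=> v0.
have -> : pi = pi / 2 - - (pi / 2) :> R by field.
apply: (@ge0_line_integral _ _ (fun x => atan ((x - u) / v))).
- by move=> x; rewrite divr_ge0 ?(ltW v0) // ltW // sqr_dist_gt0.
- by move=> x; apply: cvgM; [exact: cvg_cst|exact: continuous_inv_dist].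
- by move=> x; exact: is_derive_atan_affine.
- exact: cvgy_atan_affine.
- exact: cvgNy_atan_affine.
Qed.

(** In the variable r = 1 / (x - u) the quotient of the two squared distances is
a rational function equal to 1 at r = 0. *)
Lemma cvg_ln_dist_diff (F : set_system R) u v u' v' : Filter F ->
  0 < v -> (x - u)^-1 @[x --> F] --> 0 -> (\forall x \near F, x != u) ->
  0 < v' ->
  ln ((x - u') ^+ 2 + v' ^+ 2) - ln ((x - u) ^+ 2 + v ^+ 2) @[x --> F] --> (0 : R).
Proof.
move=> FF v0 Fr Fu v'0.
pose phi (r : R) := (1 - (u' - u) * r) ^+ 2 + v' ^+ 2 * r ^+ 2.
pose psi (r : R) := 1 + v ^+ 2 * r ^+ 2.
have cphi : phi ((x - u)^-1) @[x --> F] --> phi 0.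
  apply: cvgD; last by apply: cvgMr; apply: cvgM.
  by apply: cvgM; (apply: cvgB; [exact: cvg_cst|exact: cvgMr]).
have cpsi : psi ((x - u)^-1) @[x --> F] --> psi 0.
  by apply: cvgD; [exact: cvg_cst|apply: cvgMr; apply: cvgM].
have psi0 : psi 0 = 1 by rewrite /psi; ring.
have phi0 : phi 0 = 1 by rewrite /phi; ring.
have : ln (phi ((x - u)^-1) / psi ((x - u)^-1)) @[x --> F] --> (0 : R).
  have <- : ln (phi 0 / psi 0) = 0 by rewrite phi0 psi0 divr1 ln1.
  apply: (@cvg_comp _ _ _ (fun x => phi ((x - u)^-1) / psi ((x - u)^-1)) (@ln R)
    _ (nbhs (phi 0 / psi 0))).
    by apply: cvgM => //; apply: cvgV => //; rewrite psi0 oner_eq0.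
  by apply: continuous_ln; rewrite psi0 phi0 divr1.
apply: cvg_trans; apply: near_eq_cvg; near=> x.
have xu : x - u != 0 by rewrite subr_eq0; near: x.
rewrite -ln_div ?posrE ?sqr_dist_gt0 //; congr ln.
rewrite /phi /psi; field.
by rewrite xu lt0r_neq0 ?sqr_dist_gt0.
Unshelve. all: by end_near. Qed.

Lemma cvgy_inv_shift u : (x - u)^-1 @[x --> +oo] --> 0.
Proof.
apply/gtr0_cvgV0; last exact: cvg_addrr.
by near=> x; rewrite subr_gt0; near: x; exact: (nbhs_pinfty_gt (num_real _)).
Unshelve. all: by end_near. Qed.

Lemma cvgNy_inv_shift u : (x - u)^-1 @[x --> -oo] --> 0.
Proof.
apply/ltr0_cvgV0; last exact: cvg_addrr_Ny.
by near=> x; rewrite subr_lt0; near: x; exact: (nbhs_ninfty_lt (num_real _)).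
Unshelve. all: by end_near. Qed.

(** The left-hand side decays like the inverse square of the distance although
each of its two terms decays only like the inverse: with common denominator,
the numerator is quadratic in s and t. *)
Lemma dist_quotient_bound (d v v' s t : R) : 0 < v -> 0 < v' -> s - t = d ->
  `|t / (t ^+ 2 + v' ^+ 2) - s / (s ^+ 2 + v ^+ 2)| <=
  (`|d| + v + v') * ((t ^+ 2 + v' ^+ 2)^-1 + (s ^+ 2 + v ^+ 2)^-1).
Proof.
move=> v0 v'0 std.
have X0 : 0 < s ^+ 2 + v ^+ 2 by rewrite ltr_wpDl ?sqr_ge0 ?exprn_gt0.
have Y0 : 0 < t ^+ 2 + v' ^+ 2 by rewrite ltr_wpDl ?sqr_ge0 ?exprn_gt0.
set X := s ^+ 2 + v ^+ 2 in X0 *; set Y := t ^+ 2 + v' ^+ 2 in Y0 *.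
have -> : t / Y - s / X = (t * X - s * Y) / (X * Y).
  by field; rewrite !lt0r_neq0.
have -> : (`|d| + v + v') * (Y^-1 + X^-1) = (`|d| + v + v') * (X + Y) / (X * Y).
  by field; rewrite !lt0r_neq0.
rewrite normrM [`|(X * Y)^-1|]gtr0_norm ?invr_gt0 ?mulr_gt0 //.
rewrite ler_pM2r ?invr_gt0 ?mulr_gt0 //.
have -> : t * X - s * Y = s * t * d + t * v ^+ 2 - s * v' ^+ 2.
  by rewrite -std /X /Y; ring.
apply: le_trans (ler_normB _ _) _; apply: le_trans (lerD (ler_normD _ _) (lexx _)) _.
rewrite !normrM.
rewrite (gtr0_norm v0) (gtr0_norm v'0) /X /Y -(real_normK (num_real s)) -(real_normK (num_real t)).
have := normr_ge0 s; have := normr_ge0 t; have := normr_ge0 d.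
move: `|s| `|t| `|d| => a b e e0 b0 a0.
have h1 : a * b * e <= (a ^+ 2 + b ^+ 2) * e.
  by apply: ler_wpM2r => //; have := sqr_ge0 (a - b); nra.
have h2 : b * v ^+ 2 <= v * (b ^+ 2 + v ^+ 2).
  by have := sqr_ge0 (b - v); nra.
have h3 : a * v' ^+ 2 <= v' * (a ^+ 2 + v' ^+ 2).
  by have := sqr_ge0 (a - v'); nra.
nra.
Qed.

(** A conjugate Poisson kernel is not integrable, but the logarithmic
antiderivatives of two of them have the same behaviour at infinity. *)
Lemma line_integral_conjugate_poisson u v u' v' : 0 < v -> 0 < v' ->
  line_integral (fun x => (x - u') / ((x - u') ^+ 2 + v' ^+ 2)
                          - (x - u) / ((x - u) ^+ 2 + v ^+ 2)) 0.
Proof.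
move=> v0 v'0.
pose C := `|u' - u| + v + v'.
pose at_ (w z x : R) := z^-1 * atan ((x - w) / z).
have dat (w z x : R) : 0 < z -> is_derive x 1 (at_ w z) (((x - w) ^+ 2 + z ^+ 2)^-1).
  move=> z0; have := is_derive_atan_affine w x z0 => h.
  have -> : at_ w z = z^-1 \*: (fun x : R => atan ((x - w) / z)) by [].
  apply: is_derive_eq.
  by rewrite /GRing.scale /= mulrA mulVf ?lt0r_neq0 // mul1r.
have cp : continuous (fun x : R => (x - u') / ((x - u') ^+ 2 + v' ^+ 2)
                          - (x - u) / ((x - u) ^+ 2 + v ^+ 2)).
  move=> x; apply: cvgB; (apply: cvgM; last exact: continuous_inv_dist);
    (apply: cvgB; [exact: cvg_id|exact: cvg_cst]).
rewrite -[X in line_integral _ X](subrr (0 : R)).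
apply: (@dominated_line_integral _ _
  (fun x => C * (((x - u') ^+ 2 + v' ^+ 2)^-1 + ((x - u) ^+ 2 + v ^+ 2)^-1))
  (fun x => 2^-1 * (ln ((x - u') ^+ 2 + v' ^+ 2) - ln ((x - u) ^+ 2 + v ^+ 2)))
  (fun x => C * (at_ u' v' x + at_ u v x))
  _ _ (C * (v'^-1 * (pi / 2) + v^-1 * (pi / 2)))
  (C * (v'^-1 * - (pi / 2) + v^-1 * - (pi / 2)))) => //.
- by move=> x; apply: cvgMr; apply: cvgD; exact: continuous_inv_dist.
- by move=> x; apply: dist_quotient_bound => //; ring.
- move=> x.
  have h1 := is_derive_ln_dist u' x v'0; have h2 := is_derive_ln_dist u x v0.
  have -> : (fun x : R => 2^-1 * (ln ((x - u') ^+ 2 + v' ^+ 2) - ln ((x - u) ^+ 2 + v ^+ 2)))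
    = 2^-1 \*: ((fun x : R => ln ((x - u') ^+ 2 + v' ^+ 2))
               - (fun x : R => ln ((x - u) ^+ 2 + v ^+ 2))) by [].
  apply: is_derive_eq.
  by rewrite /GRing.scale /=; field; rewrite !lt0r_neq0 ?sqr_dist_gt0.
- move=> x.
  have h1 := dat u' v' x v'0; have h2 := dat u v x v0.
  have -> : (fun x : R => C * (at_ u' v' x + at_ u v x)) = C \*: (at_ u' v' + at_ u v)
    by [].
  by apply: is_derive_eq.
- rewrite -[X in _ --> X](mulr0 2^-1); apply: cvgMr; apply: cvg_ln_dist_diff => //.
    exact: cvgy_inv_shift.
  by near=> x; rewrite gt_eqF //; near: x; exact: (nbhs_pinfty_gt (num_real _)).
- rewrite -[X in _ --> X](mulr0 2^-1); apply: cvgMr; apply: cvg_ln_dist_diff => //.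
    exact: cvgNy_inv_shift.
  by near=> x; rewrite lt_eqF //; near: x; exact: (nbhs_ninfty_lt (num_real _)).
- by apply: cvgMr; apply: cvgD; apply: cvgMr; exact: cvgy_atan_affine.
- by apply: cvgMr; apply: cvgD; apply: cvgMr; exact: cvgNy_atan_affine.
Unshelve. all: by end_near. Qed.

End CauchyIntegrals.

(** * Complex line integrals and the Szego kernel *)

Section ComplexLineIntegrals.
Context {R : realType}.
Local Notation C := R[i].
Local Notation Re := complex.Re.
Local Notation Im := complex.Im.
Implicit Types (F G : R -> C) (p q z w : C).

Definition complex_line_integral F (v : C) : Prop :=
  line_integral (fun x => Re (F x)) (Re v) /\
  line_integral (fun x => Im (F x)) (Im v).

Lemma complex_line_integralD F G v w :
  complex_line_integral F v -> complex_line_integral G w ->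
  complex_line_integral (fun x => F x + G x) (v + w).
Proof.
move=> [Fr Fi] [Gr Gi]; split; rewrite raddfD /=.
  by under [fun x => _]eq_fun do rewrite raddfD /=; exact: line_integralD.
by under [fun x => _]eq_fun do rewrite raddfD /=; exact: line_integralD.
Qed.

Lemma ReM z w : Re (z * w) = Re z * Re w - Im z * Im w.
Proof. by case: z w => [a b] [c d]. Qed.

Lemma ImM z w : Im (z * w) = Re z * Im w + Im z * Re w.
Proof. by case: z w => [a b] [c d]. Qed.

Lemma complex_line_integralZ F (c v : C) :
  complex_line_integral F v -> complex_line_integral (fun x => c * F x) (c * v).
Proof.
move=> [Fr Fi]; split; rewrite ?ReM ?ImM.
  under [fun x => _]eq_fun do rewrite ReM -mulNr.
  by rewrite -mulNr; apply: line_integralD; exact: line_integralZ.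
under [fun x => _]eq_fun do rewrite ImM.
by apply: line_integralD; exact: line_integralZ.
Qed.

Lemma complex_line_integral0 : complex_line_integral (fun=> 0) 0.
Proof.
have h : line_integral (fun=> 0 : R) 0.
  by split; [exact: integrable0|rewrite /Rintegral integral0].
by split.
Qed.

Lemma complex_line_integral_sum (I : Type) (r : seq I) (P : pred I)
    (F : I -> R -> C) (v : I -> C) :
  (forall i, P i -> complex_line_integral (F i) (v i)) ->
  complex_line_integral (fun x => \sum_(i <- r | P i) F i x) (\sum_(i <- r | P i) v i).
Proof.
move=> h; elim: r => [|i r IH].
  by under [fun x => _]eq_fun do rewrite big_nil; rewrite big_nil;
    exact: complex_line_integral0.
under [fun x => _]eq_fun do rewrite big_cons; rewrite big_cons.
by case: ifPn => // Pi; apply: complex_line_integralD => //; exact: h.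
Qed.

Lemma eq_complex_line_integral F G v : F =1 G ->
  complex_line_integral F v -> complex_line_integral G v.
Proof. by move=> /funext ->. Qed.

(** The reproducing kernel of the Hardy space, up to the factor 1 / (2 pi) and
with its arguments ordered so that szego p q is the inner product of the
kernels at p and q. *)
Definition szego p q : C := 'i%C / (q - p^*).

Lemma conjE z : z^* = Re z +i* (- Im z).
Proof. by case: z. Qed.

Lemma neq_of_Im z w : Im z < Im w -> w - z != 0.
Proof. by move=> h; rewrite subr_eq0; apply: contraTneq h => ->; rewrite ltxx. Qed.

Lemma upper_sub_conj_neq0 p q : 0 < Im p -> 0 < Im q -> q - p^* != 0.
Proof.
by move=> p0 q0; apply: neq_of_Im; rewrite conjE (lt_trans _ q0) //= oppr_lt0.
Qed.

Lemma real_sub_upper_neq0 (x : R) q : 0 < Im q -> x%:C - q != 0.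
Proof.
by move=> q0; rewrite -oppr_eq0 opprB; apply: neq_of_Im.
Qed.

Lemma real_sub_conj_neq0 (x : R) p : 0 < Im p -> x%:C - p^* != 0.
Proof. by move=> p0; apply: neq_of_Im; rewrite conjE /= oppr_lt0. Qed.

Lemma invc_realE (x : R) p :
  (x%:C - p)^-1 = ((x - Re p) / ((x - Re p) ^+ 2 + Im p ^+ 2))
                   +i* (Im p / ((x - Re p) ^+ 2 + Im p ^+ 2)).
Proof.
case: p => a b; rewrite /GRing.inv /=.
by congr (_ +i* _); rewrite add0r ?sqrrN ?opprK // mulNr opprK.
Qed.

(** Partial fractions: the difference of two simple poles lying on opposite
sides of the line has a vanishing conjugate Poisson part and two Poisson
parts that add up. *)
Lemma complex_line_integral_cauchy p q : 0 < Im p -> 0 < Im q ->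
  complex_line_integral (fun x => (x%:C - p^*)^-1 * (x%:C - q)^-1)
    ((2 * pi)%:C * szego p q).
Proof.
move=> p0 q0.
have pq := upper_sub_conj_neq0 p0 q0.
apply: (@eq_complex_line_integral
  (fun x => (q - p^*)^-1 * ((x%:C - q)^-1 - (x%:C - p^*)^-1))).
  move=> x /=; have xq := real_sub_upper_neq0 x q0.
  have xp := real_sub_conj_neq0 x p0.
  by field; rewrite pq xp xq.
have -> : (2 * pi)%:C * szego p q = (q - p^*)^-1 * (0 +i* (2 * pi)).
  have -> : 0 +i* (2 * pi) = (2 * pi)%:C * 'i%C :> C by simpc.
  by rewrite /szego mulrA mulrC.
apply: complex_line_integralZ; split => /=.
  have := line_integral_conjugate_poisson (Re p) (Re q) p0 q0.
  congr line_integral; apply/funext => x.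
  by rewrite !raddfB /= !invc_realE conjE /= sqrrN.
have := line_integralD (line_integral_poisson (Re q) q0) (line_integral_poisson (Re p) p0).
rewrite (_ : pi + pi = 2 * pi); last by ring.
congr line_integral; apply/funext => x.
by rewrite !raddfB /= !invc_realE conjE /= sqrrN mulNr opprK.
Qed.

End ComplexLineIntegrals.

(** * Combinations of kernels and their Gram sums *)

Section CauchySums.
Context {R : realType}.
Local Notation C := R[i].
Local Notation Re := complex.Re.
Local Notation Im := complex.Im.
Local Notation normc := Normc.normc.
Implicit Types (p q z w : C) (s : seq (C * C)) (y : R).

Lemma sqr_normcE z : normc z ^+ 2 = Re z ^+ 2 + Im z ^+ 2.
Proof. by case: z => a b /=; rewrite sqr_sqrtr // addr_ge0 ?sqr_ge0. Qed.

Lemma normc_ge0 z : 0 <= normc z.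
Proof. by case: z => a b; exact: sqrtr_ge0. Qed.

Lemma mul_conjE z : z * z^* = (normc z ^+ 2)%:C.
Proof. by rewrite sqr_normcE; case: z => a b; rewrite conjE /=; simpc; congr (_ +i* _); ring. Qed.

Lemma Re_mul_conj z : Re (z * z^*) = normc z ^+ 2.
Proof. by rewrite mul_conjE. Qed.

Lemma normc_conj z : normc z^* = normc z.
Proof. by case: z => a b; rewrite conjE /= sqrrN. Qed.

Lemma Re_le_normc z : Re z <= normc z.
Proof.
by have /ler_normlP[] : `|Re z| <= normc z
  by rewrite -(@ler_pXn2r _ 2) ?nnegrE ?normc_ge0 // real_normK ?num_real //
       sqr_normcE lerDl sqr_ge0.
Qed.

Lemma normc_le_sqr z w :
  Re z ^+ 2 + Im z ^+ 2 <= Re w ^+ 2 + Im w ^+ 2 -> normc z <= normc w.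
Proof.
by rewrite -!sqr_normcE => h; rewrite -(@ler_pXn2r _ 2) ?nnegrE ?normc_ge0.
Qed.

Lemma normc_sum (I : Type) (r : seq I) (F : I -> C) :
  normc (\sum_(i <- r) F i) <= \sum_(i <- r) normc (F i).
Proof.
elim: r => [|i r IH]; first by rewrite !big_nil Normc.normc0.
by rewrite !big_cons; apply: le_trans (le_normcD _ _) _; rewrite lerD2l.
Qed.

Definition in_upper s := all (fun t => 0 < Im t.2) s.

(** The entry (c, p) stands for the function c / (z - conj p): the point p lies
in the upper half-plane and the pole in the lower one. *)
Definition cauchy_sum s z : C := \sum_(t <- s) t.1 / (z - t.2^*).

Definition hermitian_sum (K : C -> C -> C) s : C :=
  \sum_(t <- s) \sum_(t' <- s) t.1 * t'.1^* * K t.2 t'.2.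

Definition gram s : R := Re (hermitian_sum szego s).

(** Moving the points of s up by y amounts to evaluating the associated
function on the horizontal line at height y. *)
Definition raise y s := [seq (t.1, t.2 + y *i) | t <- s].

Lemma line_integral_cauchy_sum s : in_upper s ->
  line_integral (fun x => normc (cauchy_sum s x%:C) ^+ 2) (2 * pi * gram s).
Proof.
move=> /allP us.
have : complex_line_integral (fun x => \sum_(t <- s | t \in s) \sum_(t' <- s | t' \in s)
    t.1 * t'.1^* * ((x%:C - t.2^*)^-1 * (x%:C - t'.2)^-1))
  (\sum_(t <- s | t \in s) \sum_(t' <- s | t' \in s)
    t.1 * t'.1^* * ((2 * pi)%:C * szego t.2 t'.2)).
  apply: complex_line_integral_sum => t ts.
  apply: complex_line_integral_sum => t' ts'.
  by apply/complex_line_integralZ/complex_line_integral_cauchy; exact: us.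
case=> [+ _]; congr line_integral.
  apply/funext => x; rewrite -Re_mul_conj; congr Re.
  rewrite -big_seq /cauchy_sum rmorph_sum /= big_distrl /=.
  apply: eq_bigr => t _; rewrite -big_seq big_distrr /=; apply: eq_bigr => t' _.
  by rewrite rmorphM /= fmorphV rmorphB /= conjCK (conjE x%:C) /= oppr0; ring.
rewrite /gram /hermitian_sum -big_seq.
have -> : 2 * pi * Re (\sum_(t <- s) \sum_(t' <- s) t.1 * t'.1^* * szego t.2 t'.2)
  = Re ((2 * pi)%:C * \sum_(t <- s) \sum_(t' <- s) t.1 * t'.1^* * szego t.2 t'.2).
  by rewrite ReM /= mul0r subr0.
congr Re; rewrite big_distrr; apply: eq_bigr => t _; rewrite -big_seq big_distrr.
by apply: eq_bigr => t' _; rewrite /= mulrCA.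
Qed.

Lemma gram_ge0 s : in_upper s -> 0 <= gram s.
Proof.
move=> us; have /line_integral_ge0 := line_integral_cauchy_sum us.
by rewrite pmulr_rge0 ?mulr_gt0 ?pi_gt0 //; apply => x; rewrite sqr_ge0.
Qed.

Lemma raise_upper y s : 0 <= y -> in_upper s -> in_upper (raise y s).
Proof.
move=> y0 /allP us; apply/allP => _ /mapP[t ts ->] /=.
by rewrite raddfD /= ltr_wpDr // us.
Qed.

Lemma cauchy_sum_raise y s (x : R) :
  cauchy_sum s (x +i* y) = cauchy_sum (raise y s) x%:C.
Proof.
rewrite /cauchy_sum big_map; apply: eq_bigr => -[c p] _ /=; congr (_ / _).
by rewrite !conjE; case: p => a b; apply/eqP; rewrite eq_complex /=; apply/andP; split; apply/eqP; ring.
Qed.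

(** Schur's product theorem for the Szego kernel and its translate: the first
factor being an integral over x of rank one kernels, the sum is the integral
of the Gram sums of the translated points with coefficients c / (x - conj p). *)
Lemma schur_szego_ge0 y s : 0 <= y -> in_upper s ->
  0 <= Re (hermitian_sum (fun p q =>
         szego p q * szego (p + y *i) (q + y *i)) s).
Proof.
move=> y0 us.
pose wt x := [seq (t.1 / (x%:C - t.2^*), t.2 + y *i) | t <- s].
have uw x : in_upper (wt x).
  have := raise_upper y0 us; rewrite /in_upper /raise /wt !all_map.
  by apply: sub_all => t.
have /= : complex_line_integral (fun x => \sum_(t <- s | t \in s) \sum_(t' <- s | t' \in s)
    t.1 * t'.1^* * szego (t.2 + y *i) (t'.2 + y *i) *
      ((x%:C - t.2^*)^-1 * (x%:C - t'.2)^-1))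
  (\sum_(t <- s | t \in s) \sum_(t' <- s | t' \in s)
    t.1 * t'.1^* * szego (t.2 + y *i) (t'.2 + y *i) *
     ((2 * pi)%:C * szego t.2 t'.2)).
  move/allP: us => us.
  apply: complex_line_integral_sum => t ts.
  apply: complex_line_integral_sum => t' ts'.
  by apply/complex_line_integralZ/complex_line_integral_cauchy; exact: us.
case=> [+ _] => /line_integral_ge0 h.
have {}h := h _.
have : 0 <= Re ((2 * pi)%:C * hermitian_sum (fun p q =>
         szego p q * szego (p + y *i) (q + y *i)) s).
  apply: le_trans (h _) _.
    move=> x; have := gram_ge0 (uw x); rewrite /gram /hermitian_sum big_map.
    rewrite -big_seq => /le_trans; apply; rewrite le_eqVlt; apply/orP; left; apply/eqP.
    congr Re; apply: eq_bigr => t _; rewrite big_map -big_seq; apply: eq_bigr => t' _ /=.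
    by rewrite rmorphM /= fmorphV rmorphB /= conjCK (conjE x%:C) /= oppr0; ring.
  rewrite -big_seq le_eqVlt; apply/orP; left; apply/eqP; congr Re.
  rewrite /hermitian_sum big_distrr; apply: eq_bigr => t _; rewrite -big_seq big_distrr.
  by apply: eq_bigr => t' _ /=; ring.
by rewrite ReM /= mul0r subr0 pmulr_rge0 // mulr_gt0 ?pi_gt0.
Qed.

(** The resolvent identity 1 / A - 1 / (A + 2 i y) = 2 i y / (A (A + 2 i y)),
which turns the loss of norm at height y into a Schur product. *)
Lemma szego_raise p q y : 0 <= y -> 0 < Im p -> 0 < Im q ->
  szego p q - szego (p + y *i) (q + y *i)
  = (2 * y)%:C * (szego p q * szego (p + y *i) (q + y *i)).
Proof.
move=> y0 p0 q0.
have n1 := upper_sub_conj_neq0 p0 q0.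
have n2 : q - p^* + (2 * y) *i != 0.
  rewrite !conjE; case: p p0 n1 => a b /= p0 n1; case: q q0 n1 => c d /= q0 n1.
  by rewrite -[X in X != 0]subr0; apply: neq_of_Im => /=; lra.
have ei : (2 * y)%:C * 'i%C = (2 * y) *i :> C.
  by simpc.
have e2 : q + 0 +i* y - (p + y *i)^* = q - p^* + (2 * y) *i.
  rewrite !conjE; case: (p) (q) => a b [c d].
  by apply/eqP; rewrite eq_complex /=; apply/andP; split; apply/eqP; ring.
rewrite /szego e2.
set A := q - p^* in n1 n2 *; set Y := (2 * y) *i in ei n2 *.
have -> : (2 * y)%:C * ('i%C / A * ('i%C / (A + Y))) = Y * 'i%C / (A * (A + Y)).
  by rewrite -{2}ei; field; rewrite n1 n2.
by field; rewrite n1 n2.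
Qed.

Lemma gram_raise y s : 0 <= y -> in_upper s ->
  gram s - gram (raise y s) = 2 * y * Re (hermitian_sum (fun p q =>
         szego p q * szego (p + y *i) (q + y *i)) s).
Proof.
move=> y0 /allP us; rewrite /gram -raddfB /=.
have -> c z : c * Re z = Re (c%:C * z) by rewrite ReM /= mul0r subr0.
congr Re; rewrite /hermitian_sum big_map -sumrB big_distrr /= big_seq [RHS]big_seq.
apply: eq_bigr => t ts; rewrite big_map -sumrB big_distrr /= big_seq [RHS]big_seq.
apply: eq_bigr => t' ts'.
by rewrite -mulrBr szego_raise ?us //; ring.
Qed.

Lemma gram_raise_le y s : 0 <= y -> in_upper s -> gram (raise y s) <= gram s.
Proof.
move=> y0 us; rewrite -subr_ge0 gram_raise // mulr_ge0 ?schur_szego_ge0 //.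
by rewrite mulr_ge0.
Qed.

Lemma normc_szego_raise p q y : 0 <= y -> 0 < Im p -> 0 < Im q ->
  normc (szego (p + y *i) (q + y *i)) <= normc (szego p q).
Proof.
move=> y0 p0 q0; rewrite /szego !Normc.normcM !Normc.normcV ler_wpM2l ?normc_ge0 //.
have n0 : 0 < normc (q - p^*).
  rewrite lt_neqAle normc_ge0 andbT eq_sym; apply/eqP => /Normc.eq0_normc/eqP.
  by apply/negP/upper_sub_conj_neq0.
rewrite lef_pV2 ?posrE //; last first.
  rewrite lt_neqAle normc_ge0 andbT eq_sym; apply/eqP => /Normc.eq0_normc/eqP.
  by apply/negP/upper_sub_conj_neq0; rewrite raddfD /= ltr_wpDr.
apply: normc_le_sqr; rewrite !conjE.
by case: p p0 {n0} => a b /= b0; case: q q0 => c d /= d0; nra.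
Qed.

(** By the resolvent identity, the loss of norm at height y is at most 2 y times a constant depending on
s only. *)
Lemma gram_raise_approx s (e : R) : in_upper s -> 0 < e ->
  exists2 y, 0 < y & gram s - e < gram (raise y s).
Proof.
move=> us e0.
pose M : R := \sum_(t <- s) \sum_(t' <- s) normc t.1 * normc t'.1 * normc (szego t.2 t'.2) ^+ 2.
have M0 : 0 <= M.
  by apply: sumr_ge0 => t _; apply: sumr_ge0 => t' _; rewrite !mulr_ge0 ?normc_ge0 ?sqr_ge0.
exists (e / (2 * M + 2)); first by rewrite divr_gt0 //; lra.
set y : R := e / _.
have y0 : 0 < y by rewrite divr_gt0 //; lra.
rewrite ltrBlDr -ltrBlDl gram_raise ?(ltW y0) //.
apply: (@le_lt_trans _ _ (2 * y * M)).
  apply: ler_wpM2l; first by rewrite mulr_ge0 // ltW.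
  apply: le_trans (Re_le_normc _) _.
  apply: le_trans (normc_sum _ _) _; rewrite /M big_seq [leRHS]big_seq; apply: ler_sum => t ts.
  apply: le_trans (normc_sum _ _) _; rewrite big_seq [leRHS]big_seq; apply: ler_sum => t' ts'.
  rewrite 3!Normc.normcM normc_conj ler_wpM2l ?mulr_ge0 ?normc_ge0 //.
  rewrite expr2 ler_wpM2l ?normc_ge0 //; move/allP: us => us.
  by apply: normc_szego_raise; rewrite ?us // ltW.
have : y * (2 * M + 2) = e by rewrite /y divfK // gt_eqF //; lra.
by move=> <-; nra.
Qed.

End CauchySums.

(** * The Hardy norm: kernels and triangle inequality *)

Section HardyNorm.
Context {R : realType}.
Local Notation C := R[i].
Local Notation Re := complex.Re.
Local Notation Im := complex.Im.
Local Notation normc := Normc.normc.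
Notation mu := (@lebesgue_measure R).
Implicit Types (z w : C) (s : seq (C * C)) (y : R) (f g : upper R -> C).

Definition upper_point z (h : 0 < Im z) : upper R := exist _ z h.

Lemma extendE f z (h : 0 < Im z) : extend f z = f (upper_point h).
Proof. by rewrite /extend insubT. Qed.

Definition kernel_comb s : upper R -> C := fun t => cauchy_sum s (val t).

Lemma extend_kernel_comb s z : 0 < Im z -> extend (kernel_comb s) z = cauchy_sum s z.
Proof. by move=> h; rewrite (extendE _ h). Qed.

Definition slice f y (x : R) : R := normc (extend f (x +i* y)).

Definition continuous_slices f := forall y, 0 < y ->
  continuous (fun x : R => Re (extend f (x +i* y))) /\
  continuous (fun x : R => Im (extend f (x +i* y))).

Lemma measurable_slice f y : continuous_slices f -> 0 < y ->
  measurable_fun [set: R] (slice f y).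
Proof.
move=> cf y0; have [cr ci] := cf y y0; apply: continuous_measurable_fun => x.
rewrite /slice; have -> : (fun x : R => normc (extend f (x +i* y))) =
  (fun x : R => Num.sqrt (Re (extend f (x +i* y)) ^+ 2 + Im (extend f (x +i* y)) ^+ 2)).
  by apply/funext => t; case: extend.
apply: continuous_comp; last exact: sqrt_continuous.
by apply: cvgD; apply: cvgM; [exact: cr|exact: cr|exact: ci|exact: ci].
Qed.

Lemma extendD f g z : extend (f + g) z = extend f z + extend g z.
Proof. by rewrite /extend; case: insub => //; rewrite addr0. Qed.

Lemma extendN f z : extend (- f) z = - extend f z.
Proof. by rewrite /extend; case: insub => //; rewrite oppr0. Qed.

Lemma continuous_slicesD f g : continuous_slices f -> continuous_slices g ->
  continuous_slices (f + g).
Proof.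
move=> cf cg y y0; have [fr fi] := cf y y0; have [gr gi] := cg y y0.
split=> x; under [fun x => _]eq_fun do rewrite extendD raddfD /=.
  by apply: cvgD; [exact: fr|exact: gr].
by apply: cvgD; [exact: fi|exact: gi].
Qed.

Lemma continuous_slicesN f : continuous_slices f -> continuous_slices (- f).
Proof.
move=> cf y y0; have [fr fi] := cf y y0.
split=> x; under [fun x => _]eq_fun do rewrite extendN raddfN /=.
  by apply: cvgN; exact: fr.
by apply: cvgN; exact: fi.
Qed.

Lemma normc_realC (a : R) : `|a%:C| = `|a|%:C.
Proof. by rewrite normc_def /= expr0n /= addr0 sqrtr_sqr. Qed.

(** The norm of R[i] takes values in R[i], so a radius has to be transported
along the embedding of the real numbers before continuity along a horizontal
line can be read off. *)
Lemma continuous_line (F : C^o -> C^o) (x0 y : R) :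
  {for (x0 +i* y), continuous F} ->
  {for x0, continuous (fun x : R => Re (F (x +i* y)))} /\
  {for x0, continuous (fun x : R => Im (F (x +i* y)))}.
Proof.
move=> cF.
have key (e : R) : 0 < e -> \forall x \near (x0 : R), `|F (x0 +i* y) - F (x +i* y)| < e%:C.
  move=> e0; have /cvgrPdist_lt/(_ e%:C) := cF; rewrite ltcR => /(_ e0).
  move=> /nbhs_ballP[d /= d0 hd]; have [dr] : exists dr : R, d = dr%:C.
    by exists (Re d); rewrite RRe_real // gtr0_real.
  move=> ddr; move: d0 hd; rewrite ddr ltcR => d0 hd.
  near=> x; apply: hd; rewrite /ball /=.
  have -> : x0 +i* y - (x +i* y) = (x0 - x)%:C by simpc.
  rewrite normc_realC ltcR; near: x; exact: (@nbhsx_ballx _ _ x0 dr).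
split; apply/cvgrPdist_lt => e e0; near=> x.
  rewrite -ltcR; apply: (@le_lt_trans _ _ `|F (x0 +i* y) - F (x +i* y)|).
    by rewrite -raddfB /= normc_ge_Re.
  by near: x; exact: key.
rewrite -ltcR; apply: (@le_lt_trans _ _ `|F (x0 +i* y) - F (x +i* y)|).
  rewrite -raddfB /= normc_def lecR -sqrtr_sqr ler_wsqrtr // lerDr.
  exact: sqr_ge0.
by near: x; exact: key.
Unshelve. all: by end_near. Qed.

Lemma holomorphic_continuous_slices f : holomorphic f -> continuous_slices f.
Proof.
move=> hf y y0.
have h (x : R) : {for x +i* y, continuous (extend f : C^o -> C^o)}.
  have := hf (@upper_point (x +i* y) y0) => /derivable1_diffP.
  exact: differentiable_continuous.
by split=> x; have [] := continuous_line (h x).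
Qed.

Lemma kernel_comb_continuous_slices s : in_upper s ->
  continuous_slices (kernel_comb s).
Proof.
move=> us y y0.
have E (x : R) : extend (kernel_comb s) (x +i* y) = cauchy_sum (raise y s) x%:C.
  by rewrite -cauchy_sum_raise extend_kernel_comb.
under [fun x => Re _]eq_fun do rewrite E.
under [fun x => Im _]eq_fun do rewrite E.
have := raise_upper (ltW y0) us; move: (raise y s) => {E us y0}{}s us.
rewrite /cauchy_sum; elim: s us => [_|[c p] s IH /= /andP[p0 /IH[cr ci]]].
  by split=> x; under [fun x => _]eq_fun do rewrite big_nil; exact: cvg_cst.
have cq : continuous (fun x : R => Re (x%:C - p^*)^-1) /\
          continuous (fun x : R => Im (x%:C - p^*)^-1).
  have h1 := @continuous_inv_dist _ (Re p) _ p0.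
  split=> x; under [fun x => _]eq_fun do rewrite invc_realE conjE /= sqrrN.
    by apply: cvgM; [apply: cvgB; [exact: cvg_id|exact: cvg_cst]|exact: h1].
  by apply: cvgM; [exact: cvg_cst|exact: h1].
case: cq => c1 c2.
split=> x.
  under [fun x => _]eq_fun do rewrite big_cons raddfD /= ReM.
  apply: cvgD; last exact: cr.
  by apply: cvgB; (apply: cvgM; first exact: cvg_cst); [exact: c1|exact: c2].
under [fun x => _]eq_fun do rewrite big_cons raddfD /= ImM.
apply: cvgD; last exact: ci.
by apply: cvgD; (apply: cvgM; first exact: cvg_cst); [exact: c2|exact: c1].
Qed.

Lemma Lnorm2_sqrt (u : R -> R) (v : R) : (forall x, 0 <= u x) ->
  line_integral (fun x => u x ^+ 2) v ->
  Lnorm mu 2%:E (fun x => (u x)%:E) = (Num.sqrt v)%:E.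
Proof.
move=> u0 [iu Eu]; rewrite unlock /Lnorm.
have -> : (\int[mu]_x `|(u x)%:E| `^ 2 = v%:E)%E.
  rewrite -Eu /Rintegral fineK; last exact: integrable_fin_num.
  apply: eq_integral => x _ /=.
  by rewrite powR_mulrn // real_normK // num_real.
rewrite poweR_EFin powR12_sqrt // -Eu.
by apply: Rintegral_ge0 => x _; exact: sqr_ge0.
Qed.

Lemma Lnorm_slice y s : 0 < y -> in_upper s ->
  Lnorm mu 2%:E (fun x => (normc (extend (kernel_comb s) (x +i* y)))%:E) =
  (Num.sqrt (2 * pi * gram (raise y s)))%:E.
Proof.
move=> y0 us; apply: Lnorm2_sqrt => [x|]; first exact: normc_ge0.
have := line_integral_cauchy_sum (raise_upper (ltW y0) us).
congr line_integral; apply/funext => x.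
by rewrite -cauchy_sum_raise extend_kernel_comb.
Qed.

(** The line integrals increase as the line descends to the boundary, and
approach the Gram sum. *)
Lemma hardy_norm_kernel_comb s : in_upper s ->
  hardy_norm (kernel_comb s) = (Num.sqrt (2 * pi * gram s))%:E.
Proof.
move=> us; apply/eqP; rewrite eq_le; apply/andP; split.
  apply: ge_ereal_sup => _ [y /= y0 <-]; rewrite Lnorm_slice // lee_fin.
  by rewrite ler_wsqrtr // ler_pM2l ?mulr_gt0 ?pi_gt0 // gram_raise_le // ltW.
have ub y : 0 < y -> ((Num.sqrt (2 * pi * gram (raise y s)))%:E <= hardy_norm (kernel_comb s))%E.
  by move=> y0; rewrite -Lnorm_slice //; apply: ereal_sup_ubound; exists y.
rewrite leNgt; apply/negP => lt.
move: lt ub; case: (hardy_norm _) => [r| |] //=; last first.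
  move=> _ /(_ 1 ltr01); by rewrite leNgt ltNyr.
rewrite lte_fin => lt ub.
have r0 : 0 <= r by have := ub 1 ltr01; rewrite lee_fin; apply: le_trans; exact: sqrtr_ge0.
have tp : 0 < 2 * pi :> R by rewrite mulr_gt0 ?pi_gt0.
have rg : r ^+ 2 / (2 * pi) < gram s.
  rewrite ltr_pdivrMr // mulrC -(@sqr_sqrtr _ (2 * pi * gram s)).
    by rewrite ltr_pXn2r ?nnegrE ?sqrtr_ge0.
  by rewrite mulr_ge0 ?(ltW tp) ?gram_ge0.
have := gram_raise_approx us; move: rg; rewrite -subr_gt0 => rg /(_ _ rg)[y y0].
rewrite subKr ltr_pdivrMr // mulrC => lty.
have := ub y y0; rewrite lee_fin leNgt => /negP; apply.
rewrite -(@ltr_pXn2r _ 2) ?nnegrE ?sqrtr_ge0 // sqr_sqrtr //.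
exact: le_trans (sqr_ge0 r) (ltW lty).
Qed.

Lemma hardy_normD f g : continuous_slices f -> continuous_slices g ->
  (hardy_norm (f + g)%R <= hardy_norm f + hardy_norm g)%E.
Proof.
move=> cf cg; apply: ge_ereal_sup => _ [y /= y0 <-].
have mf := measurable_slice cf y0; have mg := measurable_slice cg y0.
have mfg := measurable_slice (continuous_slicesD cf cg) y0.
apply: (@le_trans _ _ (Lnorm mu 2%:E (EFin \o (slice f y \+ slice g y)%R))).
  rewrite unlock /Lnorm; apply: gt0_ler_poweR; rewrite ?invr_ge0 //.
  - by rewrite in_itv /= leey andbT; apply: integral_ge0 => x _; rewrite ?lee_fin powR_ge0.
  - by rewrite in_itv /= leey andbT; apply: integral_ge0 => x _; rewrite ?lee_fin powR_ge0.
  apply: ge0_le_integral => //.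
  - by move=> x _; rewrite ?lee_fin powR_ge0.
  - apply/measurable_EFinP; apply: (measurableT_comp (measurable_powR _)).
    exact: measurableT_comp.
  - apply/measurable_EFinP; apply: (measurableT_comp (measurable_powR _)).
    by apply: measurableT_comp => //; exact: measurable_funD.
  move=> x _ /=; rewrite lee_fin ge0_ler_powR ?nnegrE //.
  rewrite !ger0_norm ?normc_ge0 ?addr_ge0 ?normc_ge0 //.
  by rewrite extendD le_normcD.
have h : (1 <= 2 :> R)%R by rewrite ler1n.
apply: (le_trans (minkowski_EFin mu mf mg h)).
by apply: leeD; apply: ereal_sup_ubound; exists y.
Qed.

Lemma hardy_normN f : hardy_norm (- f) = hardy_norm f.
Proof.
congr ereal_sup; apply/seteqP; split=> _ [y y0 <-]; exists y => //;
  by congr Lnorm; apply/funext => x; rewrite extendN normcN.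
Qed.

Lemma hardy_norm_ge0 f : (0 <= hardy_norm f)%E.
Proof.
apply: (@le_trans _ _ (Lnorm mu 2%:E (fun x => (normc (extend f (x +i* 1)))%:E))).
  exact: Lnorm_ge0.
by apply: ereal_sup_ubound; exists 1 => //=; exact: ltr01.
Qed.

(** A space containing both the Hardy space and the span of the dictionary
on which the norm is subadditive: measurability of the slices and finiteness
of the norm are all that Minkowski's inequality requires. *)
Definition tame f := continuous_slices f /\ (hardy_norm f < +oo)%E.

Lemma tame_H2 f : H2 f -> tame f.
Proof. by move=> [hf ff]; split => //; exact: holomorphic_continuous_slices. Qed.

Lemma tame_kernel_comb s : in_upper s -> tame (kernel_comb s).
Proof.
move=> us; split; first exact: kernel_comb_continuous_slices.
by rewrite hardy_norm_kernel_comb // ltry.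
Qed.

Lemma tameD f g : tame f -> tame g -> tame (f + g).
Proof.
move=> [cf ff] [cg fg]; split; first exact: continuous_slicesD.
by apply: le_lt_trans (hardy_normD cf cg) _; rewrite lte_add_pinfty.
Qed.

Lemma tameN f : tame f -> tame (- f).
Proof.
by move=> [cf ff]; split; [exact: continuous_slicesN|rewrite hardy_normN].
Qed.

Lemma norm2D f g : tame f -> tame g -> norm2 (f + g) <= norm2 f + norm2 g.
Proof.
move=> tf tg; have [_ ffg] := tameD tf tg.
case: tf tg => [cf ff] [cg fg].
rewrite /norm2 -fineD ?ge0_fin_numE ?hardy_norm_ge0 //.
by rewrite fine_le ?fin_numD ?ge0_fin_numE ?hardy_norm_ge0 ?ff ?fg //; exact: hardy_normD.
Qed.

Lemma norm2N f : norm2 (- f) = norm2 f.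
Proof. by rewrite /norm2 hardy_normN. Qed.

Lemma norm2_kernel_comb s : in_upper s ->
  norm2 (kernel_comb s) = Num.sqrt (2 * pi * gram s).
Proof. by move=> us; rewrite /norm2 hardy_norm_kernel_comb. Qed.

End HardyNorm.

(** * Boundary values and inner products with the dictionary *)

Section BoundaryValues.
Context {R : realType}.
Local Notation C := R[i].
Local Notation Re := complex.Re.
Local Notation Im := complex.Im.
Local Notation normc := Normc.normc.
Implicit Types (z w p q c : C) (s r : seq (C * C)) (y : R) (f g : upper R -> C).

Lemma continuous_cauchy_sum s z : in_upper s -> 0 <= Im z ->
  {for z, continuous (cauchy_sum s : C^o -> C^o)}.
Proof.
move=> + z0; elim: s => [_|[c p] s IH /= /andP[p0 /IH cs]].
  have -> : cauchy_sum [::] = cst (0 : C) by apply/funext => w; rewrite /cauchy_sum big_nil.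
  exact: (@cst_continuous C^o C^o).
have -> : cauchy_sum ((c, p) :: s) = (fun w : C => c / (w - p^*) + cauchy_sum s w).
  by apply/funext => w; rewrite /cauchy_sum big_cons.
have zp : z - p^* != 0.
  by apply: neq_of_Im; rewrite conjE /= (lt_le_trans _ z0) // oppr_lt0.
have h1 : {for z, continuous (fun w : C^o => w - p^* : C^o)}.
  by apply: (@continuousB C C^o C^o (fun w => w) (fun=> p^*) z);
    [by move=> U|exact: (@cst_continuous C^o C^o)].
have h2 : {for z, continuous (fun w : C^o => (w - p^*)^-1 : C^o)}.
  exact: (@continuousV C C^o (fun w => w - p^*) z zp h1).
apply: (@continuousD C C^o C^o (fun w => c / (w - p^*)) (cauchy_sum s) z _ cs).
apply: (@continuousM C C^o (fun=> c) _ z _ h2).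
exact: (@cst_continuous C^o C^o).
Qed.

(** Angular limits are unique because the boundary point is adherent to each
angle; it suffices to know this for one aperture. *)
Lemma stolz_angle_proper (x : R) :
  ProperFilter (within (stolz_angle x 1) (nbhs (x%:C : C^o))).
Proof.
suff h : closure (stolz_angle x 1 : set C^o) (x%:C : C^o) by exact: (@within_nbhs_proper C^o).
move=> B /nbhs_ballP[d /= d0 hB].
have [dr ddr] : exists dr : R, d = dr%:C.
  by exists (Re d); rewrite RRe_real // gtr0_real.
move: d0 hB; rewrite ddr ltcR => d0 hB.
exists (x +i* (dr / 2)); split.
  by rewrite /stolz_angle /= subrr normr0 mul1r divr_gt0.
apply: hB; rewrite /ball /=.
have -> : x%:C - (x +i* (dr / 2)) = 0 +i* (- (dr / 2)) by simpc.
rewrite normc_def /= expr0n add0r sqrrN sqrtr_sqr ltcR ger0_norm; last by rewrite divr_ge0 // ltW.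
by rewrite ltr_pdivrMr // mulr2n mulrDr mulr1 ltrDl.
Qed.

Lemma boundary_kernel_comb s (x : R) : in_upper s ->
  boundary (kernel_comb s) x = cauchy_sum s x%:C.
Proof.
move=> us.
have lim : angular_limit (kernel_comb s) x (cauchy_sum s x%:C).
  move=> c c0.
  have cx := @continuous_cauchy_sum s x%:C us (lexx _).
  have : (cauchy_sum s : C^o -> C^o) @ within (stolz_angle x c) (nbhs (x%:C : C^o)) -->
      (cauchy_sum s x%:C : C^o).
    exact: cvg_within_filter.
  apply: cvg_trans; apply: near_eq_cvg.
  apply: filterS (withinT (stolz_angle x c) (nbhs_filter (x%:C : C^o))) => z [z0 _].
  by rewrite extend_kernel_comb.
apply: xget_unique => // l hl.
have P := stolz_angle_proper x.
apply: (@cvg_unique C^o _ _ (fmap_proper_filter _ P) _ _ (hl 1 ltr01) (lim 1 ltr01)).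
exact: norm_hausdorff.
Qed.

(** The reproducing property: the inner product with a kernel at q is, up to an
explicit factor, the value at q. *)
Lemma h2_inner_kernel_comb s c q : in_upper s -> 0 < Im q ->
  h2_inner (kernel_comb s) (kernel_comb [:: (c, q)]) =
  (2 * pi)%:C * (c^* * 'i%C * cauchy_sum s q).
Proof.
move=> us q0.
have uq : in_upper [:: (c, q)] by rewrite /= q0.
have [[_ hr] [_ hi]] : complex_line_integral
    (fun x => boundary (kernel_comb s) x * (boundary (kernel_comb [:: (c, q)]) x)^*)
    ((2 * pi)%:C * (c^* * 'i%C * cauchy_sum s q)).
  have : complex_line_integral (fun x => \sum_(t <- s | t \in s)
    t.1 * c^* * ((x%:C - t.2^*)^-1 * (x%:C - q)^-1))
    (\sum_(t <- s | t \in s) t.1 * c^* * ((2 * pi)%:C * szego t.2 q)).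
    move/allP : us => us; apply: complex_line_integral_sum => t ts.
    by apply/complex_line_integralZ/complex_line_integral_cauchy; rewrite ?us.
  congr complex_line_integral.
    apply/funext => x; rewrite !boundary_kernel_comb // -big_seq /cauchy_sum big_seq1.
    rewrite big_distrl /=; apply: eq_bigr => t _.
    by rewrite rmorphM /= fmorphV rmorphB /= conjCK (conjE x%:C) /= oppr0; ring.
  rewrite -big_seq /cauchy_sum !big_distrr /=; apply: eq_bigr => t _.
  by rewrite /szego; ring.
by rewrite /h2_inner hr hi; case: (_ * _).
Qed.

End BoundaryValues.

Section Dictionary.
Context {R : realType}.
Local Notation C := R[i].
Local Notation Re := complex.Re.
Local Notation Im := complex.Im.
Local Notation normc := Normc.normc.
Implicit Types (z w p q c : C) (s r : seq (C * C)) (y : R) (f g : upper R -> C).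

Definition kernel_coef (theta : R) (p : C) : C :=
  (cos theta +i* sin theta) / (Num.sqrt pi)%:C * (Num.sqrt (Im p))%:C.

Lemma cauchy_kernelE theta a : Im a < 0 ->
  cauchy_kernel theta a = kernel_comb [:: (kernel_coef theta a^*, a^*)].
Proof.
move=> a0; apply/funext => z; rewrite /kernel_comb /cauchy_sum big_seq1 /= conjCK.
by rewrite /cauchy_kernel /kernel_coef conjE /= ltr0_norm // mulrA.
Qed.

Lemma cauchy_dictionaryP g : cauchy_dictionary g <->
  exists theta p, 0 < Im p /\ g = kernel_comb [:: (kernel_coef theta p, p)].
Proof.
split=> [[a [theta [a0 ->]]]|[theta [p [p0 ->]]]].
  exists theta, a^*; rewrite cauchy_kernelE //; split => //.
  by rewrite conjE /= oppr_gt0.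
exists p^*, theta; have h : Im p^* < 0 by rewrite conjE /= oppr_lt0.
by rewrite cauchy_kernelE // conjCK.
Qed.

Lemma normc_real (a : R) : normc a%:C = `|a|.
Proof. by rewrite /= expr0n /= addr0 sqrtr_sqr. Qed.

Lemma sqr_normc_kernel_coef theta p : 0 < Im p ->
  normc (kernel_coef theta p) ^+ 2 = Im p / pi.
Proof.
move=> p0; rewrite /kernel_coef !Normc.normcM Normc.normcV !normc_real !exprMn exprVn.
rewrite !real_normK ?num_real // !sqr_sqrtr ?(ltW p0) ?pi_ge0 //.
  by rewrite cos2Dsin2 mul1r mulrC.
by rewrite cos2Dsin2.
Qed.

Lemma kernel_comb_cat s r : kernel_comb (s ++ r) = kernel_comb s + kernel_comb r.
Proof. by apply/funext => z; rewrite /kernel_comb /cauchy_sum big_cat. Qed.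

Lemma kernel_combZ c s :
  c *: kernel_comb s = kernel_comb [seq (c * t.1, t.2) | t <- s].
Proof.
apply/funext => z; rewrite /kernel_comb /cauchy_sum big_map.
transitivity (c * \sum_(t <- s) t.1 / (\val z - t.2^*)) => //; rewrite big_distrr /=.
by apply: eq_bigr => t _ /=; rewrite mulrA.
Qed.

Lemma sub_upper p : p - p^* = (2 * Im p)%:C * 'i%C.
Proof.
by case: p => a b; rewrite conjE; apply/eqP; rewrite eq_complex /=; apply/andP; split; apply/eqP; ring.
Qed.

Lemma szego_diag w : 0 < Im w -> szego w w = ((2 * Im w)^-1)%:C.
Proof.
move=> w0; rewrite /szego sub_upper.
have i0 : 'i%C != 0 :> C by rewrite eq_complex /= oner_eq0 andbF.
have w2 : (2 * Im w)%:C != 0 :> C by rewrite eq_complex /= eqxx andbT gt_eqF // mulr_gt0.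
move: (2 * Im w) w2 => k k0.
have -> : (k^-1)%:C = (k%:C)^-1 :> C by rewrite fmorphV.
by rewrite invfM mulrCA mulfV // mulr1.
Qed.

Lemma conj_szego p q : (szego p q)^* = szego q p.
Proof.
rewrite /szego rmorphM /= fmorphV rmorphB /= conjCK (conjE 'i%C) /=.
have -> : 0 +i* -1 = - 'i%C :> C by simpc.
by rewrite -[q^* - p]opprB invrN mulrNN.
Qed.

(** Subtracting from a combination its orthogonal projection on the kernel at
the point w; this is the reproducing property in the form of Pythagoras. *)
Lemma gram_project s w : 0 < Im w ->
  gram ((- ((2 * Im w)%:C * 'i%C * cauchy_sum s w), w) :: s) =
  gram s - 2 * Im w * normc (cauchy_sum s w) ^+ 2.
Proof.
move=> w0; set F := cauchy_sum s w; set m : C := - _.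
have sF : \sum_(t <- s) t.1 * szego t.2 w = 'i%C * F.
  rewrite /F /cauchy_sum big_distrr /=; apply: eq_bigr => t _.
  by rewrite /szego; ring.
have sF' : \sum_(t <- s) t.1^* * szego w t.2 = ('i%C * F)^*.
  rewrite -sF rmorph_sum; apply: eq_bigr => t _ /=.
  by rewrite rmorphM /= conj_szego.
have E : hermitian_sum szego ((m, w) :: s) =
   m * m^* * ((2 * Im w)^-1)%:C + m * ('i%C * F)^* + m^* * ('i%C * F) + hermitian_sum szego s.
  rewrite /hermitian_sum !big_cons /= szego_diag // -sF' -sF -!addrA; congr (_ + _).
  rewrite big_distrr /=; congr (_ + _).
    by apply: eq_bigr => t _; rewrite -mulrA.
  rewrite big_distrr /= -big_split /=; apply: eq_bigr => t _.
  by rewrite big_cons /=; congr (_ + _); ring.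
rewrite /gram E [in LHS]raddfD /= addrC; congr (_ + _).
have -> : m = - ((2 * Im w)%:C * ('i%C * F)) by rewrite /m; ring.
have -> : normc F = normc ('i%C * F).
  by rewrite Normc.normcM /= expr0n expr1n add0r sqrtr1 mul1r.
rewrite sqr_normcE; move: ('i%C * F) => [a b]; rewrite !conjE /=.
by field; rewrite gt_eqF.
Qed.

End Dictionary.

(** * The two-kernel inequality *)

Section TwoKernels.
Context {R : realType}.
Local Notation C := R[i].
Local Notation Re := complex.Re.
Local Notation Im := complex.Im.
Local Notation normc := Normc.normc.
Implicit Types (z w p q c : C) (s : seq (C * C)).

Lemma complex_ext z w : Re z = Re w -> Im z = Im w -> z = w.
Proof. by case: z w => a b [c d] /= -> ->. Qed.

Lemma sqr_normcV z : normc z^-1 ^+ 2 = (normc z ^+ 2)^-1.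
Proof. by rewrite Normc.normcV exprVn. Qed.

Lemma sqr_normcM z w : normc (z * w) ^+ 2 = normc z ^+ 2 * normc w ^+ 2.
Proof. by rewrite Normc.normcM exprMn. Qed.

Lemma sqr_normc_gt0 z : z != 0 -> 0 < normc z ^+ 2.
Proof.
move=> z0; rewrite exprn_gt0 // lt_neqAle normc_ge0 andbT eq_sym.
by apply: contra z0 => /eqP/Normc.eq0_normc/eqP.
Qed.

Section Normalized.
Variables (p q c1 c2 : C).
Hypotheses (p0 : 0 < Im p) (q0 : 0 < Im q) (pq : p * q = -1).
Let N := c1 + c2.
Let M := - (c1 * q^* + c2 * p^*).
Let eta := Im p + Im q.
Let s := [:: (c1, p); (c2, q)].
Let rho := Re p ^+ 2 + Im p ^+ 2.

Let rho0 : 0 < rho.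
Proof. by rewrite /rho ltr_wpDl ?sqr_ge0 // exprn_gt0. Qed.

Let qE : q = (- Re p / rho) +i* (Im p / rho).
Proof.
have pn : p != 0 by rewrite -[p]subr0; apply: neq_of_Im.
apply: (mulfI pn); rewrite pq.
have := rho0; rewrite /rho; move: p pn => [u v] /= _ r0.
by apply: complex_ext => /=; field; rewrite gt_eqF.
Qed.

Let etaE : eta = Im p * (rho + 1) / rho.
Proof. by rewrite /eta qE /=; field; rewrite gt_eqF. Qed.

Let eta0 : 0 < eta. Proof. by rewrite addr_gt0. Qed.

Lemma szego_normalized : szego p q = (Im p / (rho + 1)) +i* (- Re p / (rho + 1)).
Proof.
have n0 := upper_sub_conj_neq0 p0 q0.
apply: (mulIf n0); rewrite /szego divfK // qE.
have := rho0; rewrite /rho; case: p => u v /= r0; rewrite conjE.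
by apply: complex_ext => /=; field; rewrite !gt_eqF // ltr_wpDr.
Qed.

(** In terms of the numerator N z + M of the combination the form is diagonal,
with equal coefficients. *)
Lemma gram_normalized :
  gram s = (normc N ^+ 2 + normc M ^+ 2) / (2 * eta).
Proof.
rewrite /gram /hermitian_sum /s !big_cons !big_nil /= !addr0.
rewrite !szego_diag // -(conj_szego p q) szego_normalized etaE /N /M qE !conjE.
rewrite !sqr_normcE; have := rho0; rewrite /rho; move: p0.
case: p c1 c2 => [u v] [a b] [c d] /= v0 r0.
by field; rewrite !gt_eqF // ltr_wpDr.
Qed.

Let wq_neq0 w : 0 < Im w -> w - q^* != 0.
Proof. exact: upper_sub_conj_neq0. Qed.

Let wp_neq0 w : 0 < Im w -> w - p^* != 0.
Proof. exact: upper_sub_conj_neq0. Qed.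

Lemma cauchy_sum_normalized w : 0 < Im w ->
  cauchy_sum s w = (N * w + M) / ((w - p^*) * (w - q^*)).
Proof.
move=> w0; rewrite /cauchy_sum /s !big_cons big_nil /= addr0 /N /M.
by field; rewrite wp_neq0 ?wq_neq0.
Qed.

Lemma Im_inversion w : Im (- w^-1) = Im w / normc w ^+ 2.
Proof. by rewrite sqr_normcE; case: w => x y /=; rewrite opprK. Qed.

Lemma inversion_upper w : 0 < Im w -> 0 < Im (- w^-1).
Proof.
move=> w0; rewrite Im_inversion divr_gt0 // sqr_normc_gt0 //.
by rewrite -[w]subr0; apply: neq_of_Im.
Qed.

(** The isometry f(z) |-> f(-1/z) / z preserves the pair of kernels and acts on
the numerators by (N, M) |-> (-M, N). *)
Lemma cauchy_sum_inversion w : 0 < Im w ->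
  cauchy_sum s (- w^-1) = w * (N - M * w) / ((w - p^*) * (w - q^*)).
Proof.
move=> w0; rewrite cauchy_sum_normalized ?inversion_upper //.
have wn : w != 0 by rewrite -[w]subr0; apply: neq_of_Im.
have pqc : p^* * q^* = -1 by rewrite -rmorphM pq rmorphN1.
have -> : (- w^-1 - p^*) * (- w^-1 - q^*) = - ((w - p^*) * (w - q^*)) / w ^+ 2.
  have -> : - ((w - p^*) * (w - q^*)) / w ^+ 2
    = - (w ^+ 2 - (p^* + q^*) * w + p^* * q^*) / w ^+ 2 by congr (- _ / _); ring.
  have -> : (- w^-1 - p^*) * (- w^-1 - q^*) = (w ^-1) ^+ 2 + (p^* + q^*) / w + p^* * q^*
    by ring.
  by rewrite pqc; field.
by field; rewrite wn wp_neq0 ?wq_neq0.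
Qed.

(** Averaging over the orbit of w leaves of the cross terms only
Im (N conj M), which is controlled by the diagonal ones; the loss is the factor
|w - i|^2, which measures how far w is from the fixed point i. *)
Lemma inversion_pair_lower_bound w : 0 < Im w ->
  Im w * (normc N ^+ 2 + normc M ^+ 2) * normc (w - 'i%C) ^+ 2
    / (normc (w - p^*) ^+ 2 * normc (w - q^*) ^+ 2) <=
  Im w * normc (cauchy_sum s w) ^+ 2
  + Im (- w^-1) * normc (cauchy_sum s (- w^-1)) ^+ 2.
Proof.
move=> w0; rewrite Im_inversion cauchy_sum_inversion // cauchy_sum_normalized //.
rewrite !(sqr_normcM, sqr_normcV).
have Pp := sqr_normc_gt0 (wp_neq0 w0); have Pq := sqr_normc_gt0 (wq_neq0 w0).
have wn : 0 < normc w ^+ 2.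
  by apply: sqr_normc_gt0; rewrite -[w]subr0; apply: neq_of_Im.
move: (normc (w - p^*) ^+ 2) (normc (w - q^*) ^+ 2) (normc w ^+ 2) Pp Pq wn => A B W A0 B0 W0.
have -> : Im w * (normc (N * w + M) ^+ 2 * (A * B)^-1) +
    Im w / W * (W * normc (N - M * w) ^+ 2 * (A * B)^-1)
  = Im w * (normc (N * w + M) ^+ 2 + normc (N - M * w) ^+ 2) / (A * B).
  by field; rewrite !gt_eqF.
rewrite ler_pM2r ?invr_gt0 ?mulr_gt0 // -mulrA ler_pM2l //.
rewrite -subr_ge0 !sqr_normcE.
case: N M => [n1 n2] [m1 m2]; case: w w0 => x y /= y0.
set D := (X in 0 <= X).
have -> : D = 2 * y * ((n1 + m2) ^+ 2 + (n2 - m1) ^+ 2) by rewrite /D; ring.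
by rewrite mulr_ge0 ?mulr_ge0 ?(ltW y0) // addr_ge0 ?sqr_ge0.
Qed.

(** The point p itself serves unless it is close to i, where the factor
|w - i|^2 vanishes; then both p and q = -1/p are close to i, and 3i is at a
bounded hyperbolic distance from them. *)
Lemma exists_test_point : exists2 w, 0 < Im w &
  normc (w - p^*) ^+ 2 * normc (w - q^*) ^+ 2 <=
  32 * eta * Im w * normc (w - 'i%C) ^+ 2.
Proof.
have r0 := rho0.
have [le|gt] := leP (16 * Im p) (7 * (rho + 1)).
  exists p => //.
  have eA : normc (p - p^*) ^+ 2 = 4 * Im p ^+ 2.
    by rewrite sqr_normcE conjE; case: (p) => u v /=; ring.
  have eB : normc (p - q^*) ^+ 2 = (rho + 1) ^+ 2 / rho.
    rewrite sqr_normcE qE conjE; move: r0; rewrite /rho; case: (p) => u v /= r0.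
    by field; rewrite gt_eqF.
  have eC : normc (p - 'i%C) ^+ 2 = rho + 1 - 2 * Im p.
    by rewrite sqr_normcE /rho; case: (p) => u v /=; ring.
  rewrite eA eB eC etaE; move: (Im p) rho p0 le r0 => v r v0 le r0.
  rewrite -subr_ge0.
  have -> : 32 * (v * (r + 1) / r) * v * (r + 1 - 2 * v) - 4 * v ^+ 2 * ((r + 1) ^+ 2 / r)
    = 4 * v ^+ 2 * (r + 1) / r * (7 * (r + 1) - 16 * v).
    by field; rewrite gt_eqF.
  apply: mulr_ge0; last by rewrite subr_ge0.
  have r1 : 0 <= r + 1 by rewrite addr_ge0 // ltW.
  by rewrite divr_ge0 ?(ltW r0) // mulr_ge0 // mulr_ge0 // sqr_ge0.
exists (0 +i* 3) => //=.
rewrite -sqr_normcM !sqr_normcE.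
pose K := (rho + 1) ^+ 2 / rho.
have etaK : 7 * K < 16 * eta.
  rewrite etaE /K; have -> : 7 * ((rho + 1) ^+ 2 / rho) = 7 * (rho + 1) * ((rho + 1) / rho) by ring.
  have -> : 16 * (Im p * (rho + 1) / rho) = 16 * Im p * ((rho + 1) / rho) by ring.
  by rewrite ltr_pM2r // divr_gt0 // addr_gt0.
have K4 : 4 <= K.
  rewrite /K ler_pdivlMr // -subr_ge0.
  have -> : (rho + 1) ^+ 2 - 4 * rho = (rho - 1) ^+ 2 by ring.
  exact: sqr_ge0.
have tauK : (Re p * (1 - rho^-1)) ^+ 2 + eta ^+ 2 <= K.
  rewrite etaE -subr_ge0.
  have -> : K - ((Re p * (1 - rho^-1)) ^+ 2 + (Im p * (rho + 1) / rho) ^+ 2)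
    = 4 * Re p ^+ 2 / rho.
    have : Im p ^+ 2 = rho - Re p ^+ 2 by rewrite /rho; ring.
    move: (Im p) (Re p) => v u; rewrite /K => ev.
    have -> : (v * (rho + 1) / rho) ^+ 2 = v ^+ 2 * ((rho + 1) / rho) ^+ 2 by ring.
    by rewrite ev; field; rewrite gt_eqF.
  by rewrite divr_ge0 ?(ltW r0) // mulr_ge0 // sqr_ge0.
rewrite qE !conjE.
have -> : Re ((0 +i* 3 - (Re p +i* - Im p)) * (0 +i* 3 - (- Re p / rho +i* - (Im p / rho))))
   = - (10 + 3 * eta).
  rewrite etaE; move: r0; rewrite /rho; case: (p) => u v /= r0.
  by field; rewrite gt_eqF.
have -> : Im ((0 +i* 3 - (Re p +i* - Im p)) * (0 +i* 3 - (- Re p / rho +i* - (Im p / rho))))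
   = - 3 * (Re p * (1 - rho^-1)).
  move: r0; rewrite /rho; case: (p) => u v /= r0.
  by field; rewrite gt_eqF.
move: (Re p * (1 - rho^-1)) tauK => t tauK.
by rewrite sqr_sqrtr ?addr_ge0 ?sqr_ge0 //; nra.
Qed.

Lemma two_kernels_normalized : exists2 w, 0 < Im w &
  gram s <= 32 * Im w * normc (cauchy_sum s w) ^+ 2.
Proof.
have [w w0 hw] := exists_test_point.
have := inversion_pair_lower_bound w0.
set P := _ * normc (w - q^*) ^+ 2 in hw *.
have P0 : 0 < P by rewrite mulr_gt0 ?sqr_normc_gt0 ?wp_neq0 ?wq_neq0.
rewrite ler_pdivrMr // => hs.
have iw := inversion_upper w0.
have hg : gram s <= 16 * (Im w * normc (cauchy_sum s w) ^+ 2
  + Im (- w^-1) * normc (cauchy_sum s (- w^-1)) ^+ 2).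
  rewrite gram_normalized ler_pdivrMr ?mulr_gt0 //.
  set Q := normc N ^+ 2 + _ in hs *; set S := _ + Im (- w^-1) * _ in hs *.
  have Q0 : 0 <= Q by rewrite addr_ge0 ?sqr_ge0.
  rewrite -(ler_pM2r P0).
  apply: le_trans (ler_wpM2l Q0 hw) _.
  have : 0 <= 32 * eta by rewrite mulr_ge0 // ltW.
  move/ler_wpM2l => /(_ _ _ hs) h.
  by apply: le_trans (le_trans _ h) _; rewrite le_eqVlt; apply/orP; left; apply/eqP; ring.
have [le|le] := leP (Im (- w^-1) * normc (cauchy_sum s (- w^-1)) ^+ 2)
  (Im w * normc (cauchy_sum s w) ^+ 2).
  by exists w => //; apply: le_trans hg _; lra.
by exists (- w^-1) => //; apply: le_trans hg _; lra.
Qed.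

End Normalized.

Definition affine (x0 y0 : R) p : C := x0%:C + y0%:C * p.

Lemma affine_sub_conj (x0 y0 : R) p q :
  affine x0 y0 q - (affine x0 y0 p)^* = y0%:C * (q - p^*).
Proof.
rewrite !conjE /affine; case: p q => [a b] [c d].
by apply: complex_ext => /=; ring.
Qed.

Lemma gram_affine (x0 y0 : R) s : 0 < y0 ->
  gram [seq (t.1, affine x0 y0 t.2) | t <- s] = gram s / y0.
Proof.
move=> y00; rewrite /gram.
have -> : Re (hermitian_sum szego s) / y0 = Re (y0^-1%:C * hermitian_sum szego s).
  by rewrite ReM /= mul0r subr0 mulrC.
congr Re; rewrite /hermitian_sum big_map big_distrr; apply: eq_bigr => t _.
rewrite big_map big_distrr; apply: eq_bigr => t' _ /=.
rewrite /szego affine_sub_conj invfM.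
have -> : y0^-1%:C = y0%:C^-1 :> C by rewrite fmorphV.
by ring.
Qed.

Lemma cauchy_sum_affine (x0 y0 : R) s w : 0 < y0 ->
  normc (cauchy_sum [seq (t.1, affine x0 y0 t.2) | t <- s] (affine x0 y0 w)) ^+ 2 =
  normc (cauchy_sum s w) ^+ 2 / y0 ^+ 2.
Proof.
move=> y00.
have -> : cauchy_sum [seq (t.1, affine x0 y0 t.2) | t <- s] (affine x0 y0 w) =
  y0%:C^-1 * cauchy_sum s w.
  rewrite /cauchy_sum big_map big_distrr; apply: eq_bigr => t _ /=.
  by rewrite affine_sub_conj invfM mulrCA.
by rewrite sqr_normcM sqr_normcV normc_real real_normK ?num_real // mulrC.
Qed.

(** With k = (Re p - Re q) / (Im p + Im q), the translation by - x0 carries p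
and q to Im p (k + i) and Im q (-k + i), whose product is the negative real
number - Im p Im q (1 + k^2); the dilation by 1 / y0 makes it -1. *)
Lemma two_kernels p q c1 c2 : 0 < Im p -> 0 < Im q ->
  exists2 w, 0 < Im w & gram [:: (c1, p); (c2, q)]
    <= 32 * Im w * normc (cauchy_sum [:: (c1, p); (c2, q)] w) ^+ 2.
Proof.
move=> p0 q0.
pose k := (Re p - Re q) / (Im p + Im q).
pose y0 := Num.sqrt (Im p * Im q * (1 + k ^+ 2)).
pose x0 := (Re p * Im q + Re q * Im p) / (Im p + Im q).
have yy : 0 < Im p * Im q * (1 + k ^+ 2).
  by rewrite !mulr_gt0 // ltr_pwDl ?sqr_ge0.
have y00 : 0 < y0 by rewrite sqrtr_gt0.
have y2 : y0 ^+ 2 = Im p * Im q * (1 + k ^+ 2) by rewrite sqr_sqrtr // ltW.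
pose p' := (Im p / y0 * k) +i* (Im p / y0).
pose q' := (- (Im q / y0 * k)) +i* (Im q / y0).
have p'0 : 0 < Im p' by rewrite divr_gt0.
have q'0 : 0 < Im q' by rewrite divr_gt0.
have pq' : p' * q' = -1.
  apply: complex_ext => /=; last by ring.
  have -> : Im p / y0 * k * - (Im q / y0 * k) - Im p / y0 * (Im q / y0) =
    - (Im p * Im q * (1 + k ^+ 2) / y0 ^+ 2) by field; rewrite gt_eqF.
  by rewrite y2 divff // gt_eqF.
have pE : p = affine x0 y0 p'.
  rewrite /affine /p' /x0 /k; move: p0 q0 y00; case: (p) (q) => [a b] [c d] /= b0 d0 y00.
  by apply: complex_ext => /=; field; rewrite !gt_eqF // addr_gt0.
have qE : q = affine x0 y0 q'.
  rewrite /affine /q' /x0 /k; move: p0 q0 y00; case: (p) (q) => [a b] [c d] /= b0 d0 y00.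
  by apply: complex_ext => /=; field; rewrite !gt_eqF // addr_gt0.
have [w w0 hw] := two_kernels_normalized c1 c2 p'0 q'0 pq'.
exists (affine x0 y0 w).
  by rewrite /affine raddfD /= ImM /= mul0r addr0 add0r mulr_gt0.
have -> : [:: (c1, p); (c2, q)] =
  [seq (t.1, affine x0 y0 t.2) | t <- [:: (c1, p'); (c2, q')]] by rewrite /= -pE -qE.
rewrite gram_affine // cauchy_sum_affine // ler_pdivrMr //.
have -> : Im (affine x0 y0 w) = y0 * Im w.
  by rewrite /affine raddfD /= ImM /= mul0r addr0 add0r.
apply: le_trans hw _; rewrite le_eqVlt; apply/orP; left; apply/eqP.
by field; rewrite gt_eqF.
Qed.

End TwoKernels.

(** * Consequences for the dictionary *)

Section Main.
Context {R : realType}.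
Local Notation C := R[i].
Local Notation Re := complex.Re.
Local Notation Im := complex.Im.
Local Notation normc := Normc.normc.
Local Notation D := (@cauchy_dictionary R).
Implicit Types (z w p q c : C) (s : seq (C * C)) (f g h : upper R -> C).

(** Bessel's inequality for the single kernel at z. *)
Lemma gram_gt0 s z : in_upper s -> 0 < Im z -> cauchy_sum s z != 0 -> 0 < gram s.
Proof.
move=> us z0 fz; have := gram_project s z0.
have uz : in_upper ((- ((2 * Im z)%:C * 'i%C * cauchy_sum s z), z) :: s).
  by rewrite /= z0.
have := gram_ge0 uz => /[swap] -> ; rewrite subr_ge0; apply: lt_le_trans.
by rewrite mulr_gt0 ?sqr_normc_gt0 // mulr_gt0.
Qed.

Lemma norm2_ge0 f : 0 <= norm2 f.
Proof. by rewrite fine_ge0 // hardy_norm_ge0. Qed.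

Lemma sqr_norm2_kernel_comb s : in_upper s ->
  norm2 (kernel_comb s) ^+ 2 = 2 * pi * gram s.
Proof.
move=> us; rewrite norm2_kernel_comb // sqr_sqrtr //.
by rewrite !mulr_ge0 ?pi_ge0 // gram_ge0.
Qed.

Lemma dictionary_kernel w : 0 < Im w -> D (kernel_comb [:: (kernel_coef 0 w, w)]).
Proof. by move=> w0; apply/cauchy_dictionaryP; exists 0, w. Qed.

Lemma inner_two_kernels p q c1 c2 : 0 < Im p -> 0 < Im q ->
  let h := kernel_comb [:: (c1, p); (c2, q)] in h <> 0 ->
  exists2 g, D g & 4^-1 <= normc (h2_inner (((norm2 h)^-1)%:C *: h) g).
Proof.
move=> p0 q0 h hn0; pose s := [:: (c1, p); (c2, q)].
have us : in_upper s by rewrite /= p0 q0.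
have [z hz] : exists z : upper R, h z != 0.
  apply: contrapT => hz; apply: hn0; apply/funext => z.
  by apply/eqP; apply: contrapT => /negP hzn; apply: hz; exists z.
have G0 : 0 < gram s by exact: (gram_gt0 us (valP z) hz).
have [w w0 hw] := two_kernels c1 c2 p0 q0.
exists (kernel_comb [:: (kernel_coef 0 w, w)]); first exact: dictionary_kernel.
rewrite /h -/s kernel_combZ h2_inner_kernel_comb //.
have -> : cauchy_sum [seq (((norm2 (kernel_comb s))^-1)%:C * t.1, t.2) | t <- s] w =
    ((norm2 (kernel_comb s))^-1)%:C * cauchy_sum s w.
  rewrite /cauchy_sum big_map big_distrr /=.
  by apply: eq_bigr => t _; rewrite mulrA.
rewrite -(@ler_pXn2r _ 2) ?nnegrE ?normc_ge0 ?invr_ge0 //.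
rewrite !sqr_normcM normc_conj sqr_normc_kernel_coef // !normc_real.
rewrite !real_normK ?num_real // [(norm2 _)^-1 ^+ 2]exprVn sqr_norm2_kernel_comb //.
have -> : normc 'i%C ^+ 2 = 1 :> R by rewrite sqr_normcE /= expr0n expr1n add0r.
rewrite mulr1; move: hw; rewrite -/s; move: (normc (cauchy_sum s w) ^+ 2) => F hw.
have pi0 := pi_gt0 R.
move: (gram s) (Im w) (@pi R) G0 pi0 hw => G v P G0 P0 hw.
have -> : (2 * P) ^+ 2 * (v / P * ((2 * P * G)^-1 * F)) = 2 * v * F / G.
  by field; rewrite !gt_eqF.
rewrite ler_pdivlMr // exprVn.
by move: hw; lra.
Qed.

Lemma Sigma2_kernel_comb h : Sigma D 2 h ->
  exists c1 p c2 q, [/\ 0 < Im p, 0 < Im q & h = kernel_comb [:: (c1, p); (c2, q)]].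
Proof.
move=> [c [g [Dg ->]]]; rewrite big_ord_recl big_ord1.
have /cauchy_dictionaryP[t1 [p [p0 ->]]] := Dg ord0.
have /cauchy_dictionaryP[t2 [q [q0 ->]]] := Dg (lift ord0 ord0).
rewrite !kernel_combZ -kernel_comb_cat /=.
by do 4 eexists; split; [exact: p0|exact: q0|reflexivity].
Qed.

(** By Pythagoras, projecting h on the kernel at w removes at least 1/16 of the
squared norm of h, and 1 - 1/16 <= (31/32)^2. *)
Lemma improve_by_one_kernel h : Sigma D 2 h ->
  exists2 k, Sigma D 1 k & tame k /\ norm2 (h - k) <= 31 / 32 * norm2 h.
Proof.
move=> /Sigma2_kernel_comb[c1 [p [c2 [q [p0 q0 ->]]]]].
set s := [:: _; _]; have us : in_upper s by rewrite /= p0 q0.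
have [w w0 hw] := two_kernels c1 c2 p0 q0.
set m := (2 * Im w)%:C * 'i%C * cauchy_sum s w.
have gn0 : kernel_coef 0 w != 0.
  apply: contraTneq (divr_gt0 w0 (pi_gt0 R)) => e.
  by rewrite -(sqr_normc_kernel_coef 0 w0) e Normc.normc0 expr0n ltxx.
exists (kernel_comb [:: (m, w)]).
  exists (fun=> m / kernel_coef 0 w), (fun=> kernel_comb [:: (kernel_coef 0 w, w)]).
  split; first by move=> _; exact: dictionary_kernel.
  by rewrite big_ord1 kernel_combZ /= divfK.
split; first by apply: tame_kernel_comb; rewrite /= w0.
have -> : kernel_comb s - kernel_comb [:: (m, w)] = kernel_comb ((- m, w) :: s).
  have -> : - kernel_comb [:: (m, w)] = kernel_comb [:: (- m, w)].
    by rewrite -scaleN1r kernel_combZ /= mulN1r.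
  by rewrite addrC -kernel_comb_cat.
have um : in_upper ((- m, w) :: s) by rewrite /= w0 p0 q0.
rewrite -(@ler_pXn2r _ 2) ?nnegrE ?norm2_ge0 ?mulr_ge0 ?divr_ge0 ?norm2_ge0 //.
rewrite exprMn !sqr_norm2_kernel_comb // /m gram_project //.
have pi0 := pi_gt0 R; have G0 := gram_ge0 us.
rewrite [leRHS]mulrCA ler_pM2l ?mulr_gt0 //.
move: hw; rewrite -/s; move: (normc (cauchy_sum s w) ^+ 2) (Im w) (gram s) G0 => F v G G0 hw.
by lra.
Qed.

Lemma cauchy_dictionary_not_universal : ~ universal (@H2 R) (@norm2 R) D.
Proof.
(* A kernel lowers the norm of a combination of two kernels by 1/32 of it,
   hence that of x by about 4/128 - 2/128, more than the gap 1/128 allows. *)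
pose alpha (n : nat) : R :=
  if n is n'.+1 then if n' is _.+1 then 2^-1 ^+ (n + 6) else 127 / 128 else 1.
move=> /(_ alpha)[].
- case=> [|[|n]]; rewrite /alpha; first by lra.
    by rewrite !exprS expr0; lra.
  rewrite (addSn n.+2) exprS.
  have : 0 < 2^-1 ^+ (n.+2 + 6) :> R by rewrite exprn_gt0.
  by move: (2^-1 ^+ _) => X X0; lra.
- have h : (2^-1 ^+ n : R) @[n --> \oo] --> (0 : R).
    by apply: cvg_expr; rewrite ger0_norm ?invr_ge0 // invf_lt1 ?ltr1n.
  have : (2^-1 ^+ (n + 6) : R) @[n --> \oo] --> (0 : R) by rewrite (cvg_shiftn 6).
  apply: cvg_trans; apply: near_eq_cvg; near=> n.
  have : (2 <= n)%N by near: n; exact: nbhs_infty_ge.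
  by rewrite /alpha; case: (n) => [|[|]].
move=> x Hx sx; have tx := tame_H2 Hx.
have lb m : has_lbound [set norm2 (x - h) | h in Sigma D m].
  by exists 0 => _ [h _ <-]; exact: norm2_ge0.
have nx : norm2 x = 1.
  have := sx 0; rewrite /sigma.
  have -> : [set norm2 (x - h) | h in Sigma D 0] = [set norm2 x].
    apply/seteqP; split=> [_ [h [c [g [_ ->]]] <-]|_ ->].
      by rewrite big_ord0 subr0.
    exists 0; last by rewrite subr0.
    exists (fun=> 0), (fun=> 0); split; first by case.
    by rewrite big_ord0.
  by rewrite inf1.
have [h Sh hx] : exists2 h, Sigma D 2 h & norm2 (x - h) < 1 / 128.
  have : inf [set norm2 (x - h) | h in Sigma D 2] < 1 / 128.
    have := sx 2; rewrite /sigma => ->.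
    have -> : alpha 2 = 1 / 256 by rewrite /alpha -[(2 + 6)%N]/8%N; field.
    by lra.
  case/inf_lt => [|_ [h Sh <-] hx]; last by exists h.
  exists (norm2 (x - (\sum_(k < 2) 0 *: kernel_comb [:: (kernel_coef 0 'i%C, 'i%C)]))).
  eexists; last reflexivity.
  exists (fun=> 0), (fun=> kernel_comb [:: (kernel_coef 0 'i%C, 'i%C)]).
  by split => // _; apply: dictionary_kernel.
have th : tame h.
  have [c1 [p [c2 [q [p0 q0 ->]]]]] := Sigma2_kernel_comb Sh.
  by apply: tame_kernel_comb; rewrite /= p0 q0.
have [k Sk [tk hk]] := improve_by_one_kernel Sh.
have nh : norm2 h <= norm2 (x - h) + 1.
  rewrite -nx -[X in X <= _](_ : norm2 (- (x - h) + x) = _); last by rewrite opprB subrK.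
  by apply: le_trans (norm2D _ _) _; rewrite ?norm2N //; apply/tameN/tameD => //; exact: tameN.
have nxk : norm2 (x - k) <= norm2 (x - h) + norm2 (h - k).
  rewrite -[X in X <= _](_ : norm2 ((x - h) + (h - k)) = _); last by rewrite addrA subrK.
  by apply: norm2D; apply: tameD => //; exact: tameN.
have : 127 / 128 <= norm2 (x - k).
  have <- : sigma (@norm2 R) D 1 x = 127 / 128 by rewrite sx.
  by apply: ge_inf => //; exists k.
by lra.
Unshelve. all: by end_near. Qed.

End Main.

Theorem theorem2 (R : realType) :
  let D := @cauchy_dictionary R in
  ((10%:R ^- 2)%:E <
    ereal_inf [set s | exists g1 g2 : upper R -> R[i],
      [/\ D g1, D g2, g1 <> g2 &
        s = ereal_sup [set (Normc.normc (h2_inner (((norm2 (g1 - g2))^-1)%:C *: (g1 - g2)) g))%:E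
                      | g in D]]])%E
  /\ ~ universal (@H2 R) (@norm2 R) D.
Proof.
split; last exact: cauchy_dictionary_not_universal.
apply: (@lt_le_trans _ _ (4^-1)%:E).
  by rewrite lte_fin exprS expr1 ltf_pV2 ?posrE ?mulr_gt0 // -natrM ltr_nat.
apply: le_ereal_inf_tmp => _ [g1 [g2 [Dg1 Dg2 g12 ->]]].
have /cauchy_dictionaryP[t1 [p [p0 e1]]] := Dg1.
have /cauchy_dictionaryP[t2 [q [q0 e2]]] := Dg2.
have E : g1 - g2 = kernel_comb [:: (kernel_coef t1 p, p); (- kernel_coef t2 q, q)].
  by rewrite e1 e2 -scaleN1r kernel_combZ -kernel_comb_cat /= mulN1r.
have n0 : kernel_comb [:: (kernel_coef t1 p, p); (- kernel_coef t2 q, q)] <> 0.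
  by rewrite -E => /eqP; rewrite subr_eq0 => /eqP.
have [g Dg le] := inner_two_kernels p0 q0 n0.
apply: (@le_trans _ _ (Normc.normc (h2_inner (((norm2 (g1 - g2))^-1)%:C *: (g1 - g2)) g))%:E).
  by rewrite lee_fin E.
by apply: ereal_sup_ubound; exists g.
Qed.
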